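(* Let $\Gamma=(A_i,u_i)_{i=1,2}$ be a finite two-player game. For every no-regret dynamics in class $\mathcal R$, the limit set of the beliefs is almost surely internally chain transitive for continuous fictitious play.
   Context: **Game.** $\Gamma=(A_i,u_i)_{i=1,2}$ is a bimatrix game: $A_i$ is the finite action set of player $i$, $A=A_1\times A_2$, $u_i:A\to\mathbb R$ is the payoff function, extended (multi)linearly to distributions. $-i$ denotes the opponent of $i$. $\Delta(S)$ is the set of probability distributions on a finite set $S$; pure actions are identified with vertices. A correlated action is $z\in\Delta(A)$; $z_i\in\Delta(A_i)$ denotes its marginal for player $i$. **Regret.** For $z\in\Delta(A)$ and $k\in A_i$: $R_{i,k}(z)=u_i(k,z_{-i})-u_i(z)$, $R_i(z)=(R_{i,k}(z))_{k\in A_i}$, $R_{i,\max}(z)=\max_{k\in A_i}R_{i,k}(z)$. **Repeated play.** At each $t=1,2,\dots$ player $i$ chooses $a_i(t)\in A_i$; $a(t)=(a_1(t),a_2(t))$, $h(t)=(a(1),\dots,a(t))$. A strategy of player $i$ assigns to each history $h(t-1)$ a mixed action $q_i(t)\in\Delta(A_i)$, with weights $q_{i,k}(t)$; given $h(t-1)$, $a_1(t)$ and $a_2(t)$ are drawn independently from $q_1(t),q_2(t)$. The average correlated play is $z(t)=\frac1t\sum_{\tau=1}^t a(\tau)\in\Delta(A)$. Write $R_{i,k}(t)=R_{i,k}(z(t))$, and similarly $R_i(t)$, $R_{i,\max}(t)$. **Potential.** A twice differentiable convex function $P_i:\mathbb R^{A_i}\to\mathbb R$ such that, with $\mathbb R_-^{A_i}$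 the nonpositive orthant and $\nabla_k$ the partial derivative in coordinate $k$: (R1) $P_i\ge 0$ and $P_i(x)=0$ for all $x\in\mathbb R_-^{A_i}$; (R2) $\nabla P_i(\cdot)\ge 0$ and $\nabla P_i(x)\cdot x>0$ for all $x\notin\mathbb R_-^{A_i}$; (R3) if $x\notin\mathbb R_-^{A_i}$ and $x_k\le 0$, then $\nabla_kP_i(x)=0$. **Class $\mathcal R$.** The no-regret dynamics in class $\mathcal R$ are the processes $(z(t))_{t\ge1}$ generated when, for each $i=1,2$, there are a potential $P_i$ satisfying (R1)–(R3) and an action $c\in A_i$ such that (Q1) whenever $R_{i,\max}(t)>0$: $q_{i,k}(t+1)=\nabla_kP_i(R_i(t))\big/\sum_{s\in A_i}\nabla_sP_i(R_i(t))$ for all $k\in A_i$; (Q2) whenever $R_{i,\max}(t)\le 0$: $a_i(t+1)=c$. **Beliefs.** The limit set of the beliefs of a trajectory $z(t)$ is the set of all accumulation points of the marginals $(z_1(t),z_2(t))\in\Delta(A_1)\times\Delta(A_2)$ as $t\to\infty$. **Continuous fictitious play (CFP).** Let $BR_i(x_{-i})=\{x_i\in\Delta(A_i): u_i(x_i,x_{-i})=\max_{k\in A_i}u_i(k,x_{-i})\}$ and $BR(x)=BR_1(x_2)\times BR_2(x_1)$. A solution of CFP is an absolutely continuous function $x$ into $\Delta(A_1)\times\Delta(A_2)$ with $\dot x(t)\in\frac1t(BR(x(t))-x(t))$ for almost all $t$. By the change of time $y(t)=x(e^t)$ it corresponds to the best-reply dynamics $\dot y\in BR(y)-y$. **Internally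 chain transitive (ICT).** A nonempty compact set $L\subset\Delta(A_1)\times\Delta(A_2)$ is ICT for CFP (equivalently, for the best-reply dynamics) if any two points of $L$ can be connected by finitely many arbitrarily long pieces of orbits lying in $L$ with arbitrarily small jumps between them. Formally: for all $x,y\in L$, $\varepsilon>0$, $T>0$ there exist $n\ge1$, solutions $y^1,\dots,y^n$ of $\dot y\in BR(y)-y$ and times $t_1,\dots,t_n>T$ such that $y^j(s)\in L$ for all $0\le s\le t_j$, $\|y^j(t_j)-y^{j+1}(0)\|\le\varepsilon$ for $j=1,\dots,n-1$, $\|y^1(0)-x\|\le\varepsilon$ and $\|y^n(t_n)-y\|\le\varepsilon$. *)

(* Defs.v *)
From HB Require Import structures.
From mathcomp Require Import all_boot all_order all_algebra.
From mathcomp Require Import all_classical all_reals all_analysis.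
Set Implicit Arguments.
Unset Strict Implicit.
Unset Printing Implicit Defensive.
Import Order.TTheory GRing.Theory Num.Theory.
Import numFieldNormedType.Exports.
Local Open Scope classical_set_scope.
Local Open Scope ring_scope.

(* A player with m.+1 actions facing an opponent with n.+1 actions has a payoff
   matrix u whose rows are indexed by the player's own actions.  In the game
   (u1, u2), both matrices have rows indexed by A_1 and columns by A_2, so
   player 2's own point of view is obtained by transposing: it has payoffs u2^T
   and sees a correlated action z as z^T. *)

Section Game.
Context {R : realType}.

Definition simplex n : set 'rV[R]_n :=
  [set x | (forall k, 0 <= x 0 k) /\ \sum_k x 0 k = 1].

Definition vertex n (k : 'I_n) : 'rV[R]_n := delta_mx 0 k.

Definition vmax n (x : 'rV[R]_n.+1) : R := \big[Num.max/x 0 0]_k x 0 k.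

Definition payoff m n (u : 'M[R]_(m, n)) (x : 'rV[R]_m) (y : 'rV[R]_n) : R :=
  \sum_k \sum_l x 0 k * y 0 l * u k l.

Definition correlated_payoff m n (u z : 'M[R]_(m, n)) : R :=
  \sum_k \sum_l z k l * u k l.

Definition marginal m n (z : 'M[R]_(m, n)) : 'rV[R]_m :=
  \row_k \sum_l z k l.

Definition regret m n (u z : 'M[R]_(m, n)) : 'rV[R]_m :=
  \row_k (payoff u (vertex k) (marginal z^T) - correlated_payoff u z).

Definition orthant_neg n : set 'rV[R]_n := [set x | forall k, x 0 k <= 0].

Definition grad n (P : 'rV[R]_n -> R) (x : 'rV[R]_n) : 'rV[R]_n :=
  \row_k 'D_(delta_mx 0 k) P x.

Definition twice_differentiable n (P : 'rV[R]_n -> R) : Prop :=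
  (forall x, differentiable P x) /\ (forall x, differentiable (grad P) x).

Definition R1 n (P : 'rV[R]_n -> R) : Prop :=
  (forall x, 0 <= P x) /\ (forall x, orthant_neg x -> P x = 0).

Definition R2 n (P : 'rV[R]_n -> R) : Prop :=
  (forall x k, 0 <= grad P x 0 k) /\
  (forall x, ~ orthant_neg x -> 0 < \sum_k grad P x 0 k * x 0 k).

Definition R3 n (P : 'rV[R]_n -> R) : Prop :=
  forall x k, ~ orthant_neg x -> x 0 k <= 0 -> grad P x 0 k = 0.

Definition potential n (P : 'rV[R]_n -> R) : Prop :=
  [/\ twice_differentiable P, convex_function setT P, R1 P, R2 P & R3 P].

Section Play.
Context {m n : nat}.
Implicit Types h : seq ('I_m.+1 * 'I_n.+1).

Definition average_play h : 'M[R]_(m.+1, n.+1) :=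
  (size h)%:R^-1 *: \sum_(s <- h) delta_mx s.1 s.2.

(* The second clause is the deterministic choice of c, the pure action c being
   identified with a vertex of the simplex. *)
Definition no_regret_choice k l (P : 'rV[R]_k.+1 -> R) (c : 'I_k.+1)
    (u z : 'M[R]_(k.+1, l)) (q : 'rV[R]_k.+1) : Prop :=
  (0 < vmax (regret u z) ->
     forall j, q 0 j =
       grad P (regret u z) 0 j / \sum_s grad P (regret u z) 0 s) /\
  (vmax (regret u z) <= 0 -> q = vertex c).

(* The first-stage mixed actions (at the empty history) are unrestricted. *)
Definition class_R (u1 u2 : 'M[R]_(m.+1, n.+1))
    (q1 : seq ('I_m.+1 * 'I_n.+1) -> 'rV[R]_m.+1)
    (q2 : seq ('I_m.+1 * 'I_n.+1) -> 'rV[R]_n.+1) : Prop :=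
  [/\ forall h, simplex (q1 h) /\ simplex (q2 h),
      exists P1 c1, potential P1 /\ forall h, (0 < size h)%N ->
        no_regret_choice P1 c1 u1 (average_play h) (q1 h) &
      exists P2 c2, potential P2 /\ forall h, (0 < size h)%N ->
        no_regret_choice P2 c2 u2^T (average_play h)^T (q2 h)].

(* a t is the action profile of stage t >= 1; a 0 is never used. *)
Definition history (Omega : Type) (a : nat -> Omega -> 'I_m.+1 * 'I_n.+1)
    (t : nat) (w : Omega) : seq ('I_m.+1 * 'I_n.+1) :=
  [seq a s w | s <- iota 1 t].

Definition generated_by d (Omega : measurableType d) (Pr : probability Omega R)
    (q1 : seq ('I_m.+1 * 'I_n.+1) -> 'rV[R]_m.+1)
    (q2 : seq ('I_m.+1 * 'I_n.+1) -> 'rV[R]_n.+1)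
    (a : nat -> Omega -> 'I_m.+1 * 'I_n.+1) : Prop :=
  (forall t s, (0 < t)%N -> measurable [set w | a t w = s]) /\
  (forall t h k l, size h = t ->
     (Pr [set w | history a t w = h /\ a t.+1 w = (k, l)] =
      (q1 h 0 k * q2 h 0 l)%:E * Pr [set w | history a t w = h])%E).

Definition beliefs (z : 'M[R]_(m.+1, n.+1)) :
    ('rV[R]_m.+1 * 'rV[R]_n.+1)%type :=
  (marginal z, marginal z^T).

Definition belief_limit_set (Omega : Type)
    (a : nat -> Omega -> 'I_m.+1 * 'I_n.+1) (w : Omega) :
    set ('rV[R]_m.+1 * 'rV[R]_n.+1)%type :=
  cluster ((fun t => beliefs (average_play (history a t w))) @ \oo).

End Play.

Definition BRi m n (u : 'M[R]_(m.+1, n)) (y : 'rV[R]_n) : set 'rV[R]_m.+1 :=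
  [set x | simplex x /\ payoff u x y = vmax (\row_k payoff u (vertex k) y)].

Definition absolutely_continuous_on (V : normedModType R) (a b : R)
    (y : R -> V) : Prop :=
  forall e : R, 0 < e -> exists2 d : R, 0 < d &
    forall N (s t : 'I_N -> R),
      (forall i, [/\ a <= s i, s i < t i & t i <= b]) ->
      (forall i j, i != j -> t i <= s j \/ t j <= s i) ->
      \sum_i (t i - s i) < d -> \sum_i `|y (t i) - y (s i)| < e.

Section BestReply.
Context {m n : nat}.
Notation profile := ('rV[R]_m.+1 * 'rV[R]_n.+1)%type.
Variables u1 u2 : 'M[R]_(m.+1, n.+1).

Definition mixed_profiles : set profile := @simplex m.+1 `*` @simplex n.+1.

Definition BR (x : profile) : set profile := BRi u1 x.2 `*` BRi u2^T x.1.

(* Solutions live on [0, +oo[; the values of y at negative times are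
   irrelevant. *)
Definition best_reply_solution (y : R -> profile) : Prop :=
  [/\ forall s, 0 <= s -> mixed_profiles (y s),
      forall T, absolutely_continuous_on 0 T y &
      {ae lebesgue_measure, forall s : R, 0 < s ->
        exists2 b, BR (y s) b & is_derive s 1 y (b - y s)}].

(* Stated through the best-reply dynamics, i.e. continuous fictitious play after
   the change of time y(s) = x(exp s). *)
Definition internally_chain_transitive (L : set profile) : Prop :=
  [/\ L !=set0, compact L, L `<=` mixed_profiles &
    forall x y, L x -> L y -> forall e T : R, 0 < e -> 0 < T ->
    exists (N : nat) (Y : nat -> R -> profile) (t : nat -> R),
      [/\ (0 < N)%N,
          forall j, (1 <= j <= N)%N ->
            [/\ best_reply_solution (Y j), T < t j &
                forall s, 0 <= s <= t j -> L (Y j s)],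
          forall j, (1 <= j < N)%N -> `|Y j (t j) - Y j.+1 0| <= e,
          `|Y 1%N 0 - x| <= e &
          `|Y N (t N) - y| <= e]].

End BestReply.
End Game.

(* Main.v *)
Require Import Defs.
From HB Require Import structures.
From mathcomp Require Import all_boot all_order all_algebra.
From mathcomp Require Import all_classical all_reals all_analysis.
From mathcomp Require Import ring lra zify.
Set Implicit Arguments.
Unset Strict Implicit.
Unset Printing Implicit Defensive.
Import Order.TTheory GRing.Theory Num.Theory.
Import numFieldNormedType.Exports.
Local Open Scope classical_set_scope.
Local Open Scope ring_scope.

(** The proof has a probabilistic half, which shows that each player almost
    surely plays better and better replies to the empirical frequencies of the
    opponent, and a deterministic half, which shows that this property alone
    makes the limit set of the frequencies internally chain transitive.

    Probabilistic half.  Let R(t) be the vector of average regrets of a player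
    and P the potential.  Since P is convex with a continuous gradient, and since
    playing proportionally to the gradient makes the expected stage regret
    orthogonal to it ([noise_centered]), t P(R(t)) is bounded by a martingale with
    bounded increments plus o(t) ([lyapunov_step]).  Such a martingale is o(t)
    almost surely ([martingale_strong_law]), so that P(R(t)) tends to 0 and the
    maximal regret has a nonpositive upper limit ([no_regret]).  Cumulative regret
    for an action does not change at the stages where this action is played.  As
    only actions with positive regret are played when there are any, a positive
    maximal regret stays positive forever ([positive_regret_persists]).  Hence
    either all actions are eventually played with positive regret, between 0 and
    a quantity that vanishes in the limit, or the player repeats the action c from
    the second stage on, with a constant cumulative regret for it.  In both cases the action played is a
    best reply up to an error that tends to 0
    ([played_regret_asymptotically_maximal]).

    Deterministic half.  In logarithmic time the frequencies move at bounded
    speed.  Start them at stage N and let N tend to infinity along an ultrafilter: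
    the limit v(r) exists for all r, is Lipschitz, and is uniform on bounded
    intervals ([freq_stage_uniform]).  Each coordinate of exp(r) v(r) is a limit of
    numbers of visits, hence nondecreasing, and it is locally constant while the
    action is not a best reply ([limit_visits_flat]).  A Lipschitz function is
    derivable almost everywhere ([Lipschitz_derivable_ae]), and at a point of
    derivability these two facts say that v + v' is a best reply
    ([limit_freq_BR]).  So v solves the best-reply dynamics, and it stays in the
    limit set.  By contradiction, from every late stage the frequencies are
    shadowed for a given duration by a solution inside the limit set
    ([limit_set_shadowing]); concatenating such pieces between a visit near one
    point and a later visit near another gives the chains
    ([frequencies_linked]). *)

(** * Almost everywhere derivability of Lipschitz functions *)

Section Lipschitz_derivable.
Context {R : realType}.

(** Both outer measures are infima over the same covers by half-open intervals,
    and on such an interval that of [G] is at most [K] times the length. *)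
Lemma stieltjes_lebesgue_dominated (G : cumulative R R) (K : R) : 0 < K ->
  (forall x y, x <= y -> G y - G x <= K * (y - x)) ->
  lebesgue_stieltjes_measure G `<< @lebesgue_measure R.
Proof.
move=> K0 GK A nullA B mB BA.
apply/eqP; rewrite eq_le measure_ge0 andbT; apply/lee_addgt0Pr => e e0.
have B0 : (lebesgue_measure B < (e / K)%:E)%E.
  by rewrite (nullA B mB BA) lte_fin divr_gt0.
have /ereal_inf_lt [_ [F [mF BF] <-] Fe] := B0.
rewrite add0e.
apply: (@le_trans _ _ (\sum_(k <oo) wlength G (F k))%E).
  by apply: ereal_inf_lbound; exists F.
apply: (@le_trans _ _ (\sum_(k <oo) K%:E * wlength idfun (F k))%E).
  apply: lee_nneseries => [k _ _|k _]; first exact: wlength_ge0.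
  case: (mF k) => -[a b] _ <-.
  rewrite !wlength_itv /= !lte_fin; case: ifPn => [ab|_]; last by rewrite mule0.
  by rewrite -!EFinB -EFinM lee_fin GK// ltW.
rewrite nneseriesZl; last by move=> k _; exact: (wlength_ge0 (@idfun R)).
apply: (@le_trans _ _ (K%:E * (e / K)%:E)%E).
  by apply: lee_pmul => //; [rewrite lee_fin ltW|
    apply: nneseries_ge0 => k _ _; exact: (wlength_ge0 (@idfun R))| exact: ltW].
by rewrite -EFinM mulrCA divff ?mulr1// gt_eqF.
Qed.

(** By the Radon-Nikodym theorem, [G] is up to a constant the integral of a
    density on each bounded interval, and such integrals are derivable almost
    everywhere by Lebesgue's differentiation theorem. *)
Lemma nondecreasing_Lipschitz_derivable_ae (G : cumulative R R) (K : R) : 0 < K ->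
  (forall x y, x <= y -> G y - G x <= K * (y - x)) ->
  {ae lebesgue_measure, forall x : R, derivable G x 1}.
Proof.
move=> K0 GK; have Gdom := stieltjes_lebesgue_dominated K0 GK.
suff bnd (n : nat) : {ae lebesgue_measure, forall x : R, - n%:R < x < n%:R ->
    derivable G x 1}.
  have : {ae lebesgue_measure, forall x : R, forall n : nat, - n%:R < x < n%:R ->
      derivable G x 1}.
    apply/ae_foralln => n; exact: bnd.
  apply: filterS; first exact: (ae_filter_ringOfSetsType lebesgue_measure).
  move=> x /(_ (Num.trunc `|x|).+1); apply.
  by rewrite -ltr_norml; case/andP: (truncn_itv (normr_ge0 x)).
pose nu : {measure set (measurableTypeR R) -> \bar R} :=
  lebesgue_stieltjes_measure G.
pose D : set (measurableTypeR R) := `]- n%:R, n%:R]%classic.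
have mD : measurable D by exact: measurable_itv.
have nuitv (a b : R) : a <= b -> nu `]a, b]%classic = (G b - G a)%:E.
  move=> ab; rewrite /nu /= /lebesgue_stieltjes_measure /measure_extension.
  rewrite measurable_mu_extE /=; last exact: is_ocitv.
  by rewrite wlength_itv_bnd.
have n_le : - (n%:R : R) <= n%:R by rewrite (@le_trans _ _ 0) ?oppr_le0.
(* Restricting to [D] makes the measure finite, hence its density integrable. *)
have nuD : (nu D < +oo)%E by rewrite /D nuitv// ltry.
pose nuf : {finite_measure set (measurableTypeR R) -> \bar R} :=
  mfrestr mD nuD.
have nufdom : nuf `<< @lebesgue_measure R.
  move=> A nullA B mB BA; apply/eqP; rewrite eq_le measure_ge0 andbT.
  rewrite -(Gdom A nullA B mB BA) /nuf /= /mfrestr /mrestr.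
  by rewrite le_measure ?inE//; exact: measurableI.
have hI := Radon_Nikodym_SigmaFinite.f_integrable nufdom.
have hF := Radon_Nikodym_SigmaFinite.f_fin_num nufdom.
have hE := Radon_Nikodym_SigmaFinite.f_integral nufdom.
set h := Radon_Nikodym_SigmaFinite.f nuf lebesgue_measure in hI hF hE.
have hEFin : EFin \o (fine \o h) = h by apply/funext => x /=; rewrite fineK.
have locI : locally_integrable [set: R] (fine \o h).
  by apply: open_integrable_locally; [exact: openT|rewrite hEFin].
have hIy (y : R) : lebesgue_measure.-integrable
    [set` Interval (BRight (- n%:R)) (BRight y)] (EFin \o (fine \o h)).
  rewrite hEFin; apply: integrableS hI => //; exact: measurable_itv.
apply: filterS (FTC1 hIy locI).
  exact: (ae_filter_ringOfSetsType lebesgue_measure).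
move=> x + /andP[nx xn]; move=> /(_ nx)[].
set F := (F in derivable F x 1) => dF _.
have dFG : derivable (F \+ cst (G (- n%:R))) x 1.
  by apply: derivableD => //; exact: derivable_cst.
apply: near_eq_derivable dFG.
near=> y; rewrite /F /Rintegral /=.
have yn : - n%:R <= y <= n%:R.
  apply/andP; split; apply: ltW; near: y; [exact: lt_nbhsr|exact: lt_nbhsl].
rewrite (eq_integral h); last by move=> z _; rewrite /= fineK.
rewrite -hE ; last exact: measurable_itv.
rewrite /nuf /= /mfrestr /mrestr setIidl; last first.
  by move=> z /=; rewrite !in_itv /= => /andP[nz zy]; apply/andP; split => //; case/andP: yn => _; exact: le_trans.
have [yn1 yn2] := andP yn.
by rewrite -/(nu _) nuitv//= subrK.
Unshelve. all: by end_near. Qed.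

Lemma Lipschitz_derivable_ae (f : R -> R) (K : R) :
  (forall x y, `|f x - f y| <= K * `|x - y|) ->
  {ae lebesgue_measure, forall x : R, derivable f x 1}.
Proof.
move=> fK.
have K0 : 0 <= K.
  by have := fK 1 0; rewrite subr0 normr1 mulr1; exact: le_trans.
pose L := K + 1; have L0 : 0 < L by rewrite /L ltr_wpDl.
have fL x y : x <= y -> `|f y - f x| <= L * (y - x).
  move=> xy; apply: le_trans (fK y x) _.
  by rewrite ger0_norm ?subr_ge0// ler_wpM2r ?subr_ge0// lerDl.
(* Adding a steep linear function makes f monotone. *)
pose g x := f x + L * x.
have gL x y : x <= y -> `|g y - g x - L * (y - x)| <= L * (y - x).
  by move=> xy; rewrite (_ : _ - _ = f y - f x) ?fL// /g; ring.
have g_nd : nondecreasing g.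
  by move=> x y xy; have := gL _ _ xy; rewrite ler_norml => /andP[+ _]; lra.
have g_Lip x y : x <= y -> g y - g x <= (2 * L) * (y - x).
  by move=> xy; have := gL _ _ xy; rewrite ler_norml => /andP[_]; lra.
have g_rc : right_continuous g.
  move=> x; apply/(@cvgrPdist_le _ R^o) => e e0; near=> y.
  have xy : x <= y by apply: ltW; near: y; exact: nbhs_right_gt.
  rewrite distrC ger0_norm ?subr_ge0 ?g_nd//; apply: le_trans (g_Lip _ _ xy) _.
  rewrite -ler_pdivlMl ?mulr_gt0// lerBlDl; near: y.
  by apply: nbhs_right_le; rewrite ltrDl mulr_gt0// invr_gt0 mulr_gt0.
pose G : cumulative R R := HB.pack g (isCumulative.Build R _ R g g_nd g_rc).
have L20 : 0 < 2 * L by rewrite mulr_gt0.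
apply: filterS (@nondecreasing_Lipschitz_derivable_ae G _ L20 g_Lip).
  exact: (ae_filter_ringOfSetsType lebesgue_measure).
move=> x dG.
have -> : f = g \- ( *%R L).
  by apply/funext => y; rewrite /= /g addrK.
exact: derivableB.
Unshelve. all: by end_near. Qed.

End Lipschitz_derivable.

(** * Row vectors, payoffs and best replies *)

Lemma cvg_fsum (R : realType) (I : finType) (T : Type) (F : set_system T)
    {FF : Filter F} (f : I -> T -> R) (l : I -> R) :
  (forall i, f i t @[t --> F] --> l i) ->
  \sum_i f i t @[t --> F] --> \sum_i l i.
Proof. by move=> fl; apply: cvg_big => [|i _]; [exact: add_continuous|]. Qed.

Lemma pair_norm_le (R : realType) (V W : normedModType R) (x : V * W) (e : R) :
  (`|x| <= e) = (`|x.1| <= e) && (`|x.2| <= e).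
Proof. by rewrite -[`|x|]/(Num.max `|x.1| `|x.2|) ge_max. Qed.

Section RowVectors.
Context {R : realType} {n : nat}.
Implicit Types x y : 'rV[R]_n.

Lemma coord_norm_le x k : `|x 0 k| <= `|x|.
Proof.
rewrite -[leRHS]/(mx_norm x) mx_normrE.
exact: (le_bigmax 0 (fun ij : 'I_1 * 'I_n => `|x ij.1 ij.2|) (0, k)).
Qed.

Lemma row_norm_le x (e : R) : 0 <= e -> (forall k, `|x 0 k| <= e) -> `|x| <= e.
Proof.
move=> e0 xe; rewrite -[leLHS]/(mx_norm x) mx_normrE; apply/bigmax_leP; split => //.
by move=> [i k] _ /=; rewrite ord1.
Qed.

Lemma cvg_row (T : Type) (F : set_system T) {FF : Filter F}
    (f : T -> 'rV[R]_n) (l : 'rV[R]_n) :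
  (forall k, f t 0 k @[t --> F] --> l 0 k) -> f @ F --> l.
Proof.
move=> fl; apply/cvgrPdist_le => e e0.
have : \forall t \near F, forall k, `|l 0 k - f t 0 k| <= e.
  by apply: filter_forall => k; move/cvgrPdist_le : (fl k); exact.
apply: filterS => t lt; apply: row_norm_le; first exact: ltW.
by move=> k; rewrite !mxE.
Qed.

Lemma simplex_compact : compact (@simplex R n).
Proof.
apply: bounded_closed_compact.
  exists 1; split => // M M1 x [x0 x1]; apply: row_norm_le.
    by rewrite ltW// (lt_trans _ M1).
  move=> k; rewrite ger0_norm//; apply: le_trans (ltW M1).
  by rewrite -x1 (bigD1 k)//= lerDl sumr_ge0.
rewrite (_ : @simplex R n = (\bigcap_(k in [set: 'I_n]) [set x : 'rV[R]_n | 0 <= x 0 k]) `&`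
    [set x : 'rV[R]_n | \sum_k x 0 k = 1]); last first.
  by apply/seteqP; split => x /= [xk x1]; split => // k; [move=> _|]; exact: xk.
apply: closedI.
  apply: closed_bigI => k _.
  have cc : continuous (fun x : 'rV[R]_n => x 0 k) by exact: coord_continuous.
  exact: ((continuous_closedP _).1 cc _ (@closed_ge _ 0)).
have cc : continuous (fun x : 'rV[R]_n => \sum_k x 0 k).
  move=> x; apply: (@cvg_fsum _ _ _ _ (nbhs_filter x)) => k; exact: coord_continuous.
exact: ((continuous_closedP _).1 cc _ (@closed_eq _ 1)).
Qed.

End RowVectors.

Section Game.
Context {R : realType}.

Lemma le_vmax n (x : 'rV[R]_n.+1) k : x 0 k <= vmax x.
Proof. exact: (le_bigmax _ (fun k => x 0 k)). Qed.

Lemma vmax_le n (x : 'rV[R]_n.+1) c : (forall k, x 0 k <= c) -> vmax x <= c.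
Proof. by move=> xc; apply: bigmax_le. Qed.

Lemma vmaxP n (x : 'rV[R]_n.+1) : exists k, vmax x = x 0 k.
Proof.
apply: contrapT => /forallNP h.
have lt k : x 0 k < vmax x by rewrite lt_neqAle le_vmax andbT eq_sym; apply/eqP.
suff : vmax x < vmax x by rewrite ltxx.
by rewrite {1}/vmax; apply/bigmax_ltP.
Qed.

Lemma payoff_vertex m n (u : 'M[R]_(m, n)) k y :
  payoff u (vertex k) y = \sum_l y 0 l * u k l.
Proof.
rewrite /payoff (bigD1 k)//= [X in _ + X]big1 ?addr0; last first.
  by move=> i /negbTE ik; apply: big1 => l _; rewrite mxE ik andbF !mul0r.
by apply: eq_bigr => l _; rewrite mxE !eqxx mul1r.
Qed.

Lemma payoff_sum_vertex m n (u : 'M[R]_(m, n)) x y :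
  payoff u x y = \sum_k x 0 k * payoff u (vertex k) y.
Proof.
apply: eq_bigr => k _; rewrite payoff_vertex big_distrr/=.
by apply: eq_bigr => l _; rewrite mulrA.
Qed.

Lemma payoff_continuous m n (u : 'M[R]_(m, n)) k :
  continuous (fun y : 'rV[R]_n => payoff u (vertex k) y).
Proof.
move=> y; under eq_fun do rewrite payoff_vertex.
apply: (@cvg_fsum _ _ _ _ (nbhs_filter y)) => l.
by apply: cvgM; [exact: coord_continuous|exact: cvg_cst].
Qed.

(** The payoff of [b] is an average of the payoffs of the pure actions that it
    charges, all of which reach the maximum. *)
Lemma BRi_support m n (u : 'M[R]_(m.+1, n)) y b : simplex b ->
  (forall k k', payoff u (vertex k) y < payoff u (vertex k') y -> b 0 k = 0) ->
  BRi u y b.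
Proof.
move=> sb supp; split => //; set g := \row_k _.
have [k0 gk0] := vmaxP g.
rewrite payoff_sum_vertex -[RHS]mul1r -(proj2 sb) big_distrl /=.
apply: eq_bigr => k _; have := le_vmax g k; rewrite le_eqVlt => /predU1P[gk|].
  by congr (_ * _); move: gk; rewrite mxE.
by rewrite gk0 !mxE => /supp ->; rewrite !mul0r.
Qed.

End Game.

(** * Empirical frequencies in logarithmic time *)

Section Visits.
Context {n : nat}.
Implicit Types (alpha : nat -> 'I_n) (k : 'I_n).

Definition visits alpha (t : nat) k : nat :=
  (\sum_(1 <= j < t.+1) (alpha j == k))%N.

Lemma visitsS alpha t k :
  visits alpha t.+1 k = (visits alpha t k + (alpha t.+1 == k))%N.
Proof. by rewrite /visits big_nat_recr. Qed.

Lemma visits_homo alpha k t s :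
  (t <= s)%N -> (visits alpha t k <= visits alpha s k)%N.
Proof.
move=> /subnK <-; elim: (s - t)%N => // i IH.
by rewrite addSn visitsS (leq_trans IH)// leq_addr.
Qed.

Lemma visits_gap alpha k t s : (t <= s)%N ->
  (visits alpha s k <= visits alpha t k + (s - t))%N.
Proof.
move=> /subnK <-; rewrite addnK; elim: (s - t)%N => [|i IH]; first by rewrite addn0.
by rewrite addSn visitsS -[i.+1]addn1 addnA leq_add// leq_b1.
Qed.

Lemma visits_constant alpha k t s : (t <= s)%N ->
  (forall j, (t <= j < s)%N -> alpha j.+1 != k) ->
  visits alpha s k = visits alpha t k.
Proof.
move=> /subnK <-; elim: (s - t)%N => // i IH ne.
rewrite addSn visitsS (negbTE (ne _ _)) ?addn0 ?leq_addl ?addSn//=.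
by apply: IH => j /andP[tj ji]; apply: ne; rewrite tj ltnW.
Qed.

Lemma sum_visits alpha t : (\sum_k visits alpha t k = t)%N.
Proof.
rewrite /visits exchange_big /= (eq_bigr (fun=> 1%N)).
  by rewrite sum_nat_const_nat subn1 muln1.
by move=> j _; rewrite (bigD1 (alpha j))//= eqxx big1 ?addn0// => k /negbTE; rewrite eq_sym => ->.
Qed.

Lemma visits_le alpha t k : (visits alpha t k <= t)%N.
Proof. by rewrite -[leqRHS](sum_visits alpha) (bigD1 k)//= leq_addr. Qed.

End Visits.

Section Frequencies.
Context {R : realType}.

Definition freq n (alpha : nat -> 'I_n) (t : nat) : 'rV[R]_n :=
  \row_k ((visits alpha t k)%:R / t%:R).

Lemma freq_simplex n (alpha : nat -> 'I_n) t : (0 < t)%N -> simplex (freq alpha t).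
Proof.
move=> t0; split=> [k|]; first by rewrite mxE divr_ge0.
under eq_bigr do rewrite mxE.
by rewrite -mulr_suml -natr_sum sum_visits divff// pnatr_eq0 -lt0n.
Qed.

(** From stage [t] to stage [s], a fraction [1 - t / s] of the weight of the average
    is renewed. *)
Lemma freq_gap n (alpha : nat -> 'I_n) t s : (0 < t)%N -> (t <= s)%N ->
  `|freq alpha s - freq alpha t| <= 1 - t%:R / s%:R.
Proof.
move=> t0 ts.
have T0 : 0 < (t%:R : R) by rewrite ltr0n.
have TS : (t%:R : R) <= s%:R by rewrite ler_nat.
have S0 := lt_le_trans T0 TS.
have D0 : 0 <= 1 - (t%:R : R) / s%:R by rewrite subr_ge0 ler_pdivrMr// mul1r.
apply: row_norm_le => // k; rewrite !mxE.
have : (visits alpha t k)%:R <= (visits alpha s k)%:R :> R.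
  by rewrite ler_nat visits_homo.
have : (visits alpha s k)%:R <= (visits alpha t k)%:R + (s%:R - t%:R) :> R.
  by rewrite -natrB// -natrD ler_nat visits_gap.
have : (visits alpha t k)%:R <= t%:R :> R by rewrite ler_nat visits_le.
have : 0 <= (visits alpha t k)%:R :> R by [].
move: (visits alpha t k)%:R (visits alpha s k)%:R => a b a0 aT bU ab.
have bs : b / s%:R <= (a + (s%:R - t%:R)) / s%:R.
  by rewrite ler_wpM2r// invr_ge0 ltW.
have sb : a / s%:R <= b / s%:R by rewrite ler_wpM2r// invr_ge0 ltW.
have st : a / s%:R <= a / t%:R by rewrite ler_wpM2l// lef_pV2.
have at1 : a / t%:R * (1 - t%:R / s%:R) <= 1 - t%:R / s%:R.
  by rewrite ler_piMl// ler_pdivrMr// mul1r.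
have e1 : (a + (s%:R - t%:R)) / s%:R = a / s%:R + (1 - t%:R / s%:R).
  by field; rewrite gt_eqF.
have e2 : a / t%:R * (1 - t%:R / s%:R) = a / t%:R - a / s%:R.
  by field; rewrite !gt_eqF.
by rewrite ler_norml; apply/andP; split; lra.
Qed.

(** The stage reached from stage [N] after a lapse [r] of logarithmic time, the
    time scale in which frequencies move at bounded speed. *)
Definition stage (N : nat) (r : R) : nat := Num.trunc (N%:R * expR r).

Lemma stage_itv N r : (stage N r)%:R <= N%:R * expR r < (stage N r).+1%:R.
Proof. by apply: truncn_itv; rewrite mulr_ge0// expR_ge0. Qed.

Lemma stage_homo N r r' : r <= r' -> (stage N r <= stage N r')%N.
Proof. by move=> rr'; apply: le_truncn; rewrite ler_wpM2l// ler_expR. Qed.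

Lemma stage_ge N r : 0 <= r -> (N <= stage N r)%N.
Proof.
move=> r0; rewrite truncn_ge_nat ?mulr_ge0 ?expR_ge0//.
by rewrite ler_peMr// -expR0 ler_expR.
Qed.

(** The term [N^-1] pays for rounding in [stage]; the rest is the inequality
    [1 - expR (r - r') <= r' - r]. *)
Lemma stage_ratio N r r' t s : (0 < N)%N -> 0 <= r -> r <= r' ->
  (stage N r <= t)%N -> (t <= s)%N -> (s <= stage N r')%N ->
  1 - t%:R / s%:R <= r' - r + N%:R^-1.
Proof.
move=> N0 r0 rr' rt ts sr'.
have NR : 0 < (N%:R : R) by rewrite ltr0n.
have r'0 := le_trans r0 rr'.
have S0 : 0 < (s%:R : R).
  by rewrite ltr0n (leq_trans _ ts)// (leq_trans _ rt)// (leq_trans N0)// stage_ge.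
have SU : (s%:R : R) <= N%:R * expR r'.
  by apply: le_trans (proj1 (andP (stage_itv N r'))); rewrite ler_nat.
have TL : N%:R * expR r - 1 <= (t%:R : R).
  rewrite lerBlDr; apply/ltW/(lt_le_trans (proj2 (andP (stage_itv N r)))).
  by rewrite natr1 ler_nat.
have e0 : 0 < expR r' by exact: expR_gt0.
have : (N%:R * expR r - 1) / (N%:R * expR r') <= t%:R / s%:R.
  have [neg|pos] := leP (N%:R * expR r - 1) 0.
    apply: (@le_trans _ _ 0); last by rewrite divr_ge0// ltW.
    by rewrite pmulr_lle0// invr_gt0 mulr_gt0.
  apply: ler_pM => //; first exact: ltW.
  by rewrite lef_pV2// posrE mulr_gt0.
have -> : (N%:R * expR r - 1) / (N%:R * expR r') =
    expR (r - r') - (N%:R * expR r')^-1.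
  by rewrite expRD expRN; field; rewrite !gt_eqF.
have := expR_ge1Dx (r - r').
have : (N%:R * expR r')^-1 <= N%:R^-1.
  by rewrite lef_pV2 ?posrE ?mulr_gt0// ler_peMr ?(ltW NR)// -expR0 ler_expR.
lra.
Qed.

End Frequencies.

(** * Limits of the frequencies along an ultrafilter *)

Section UltraLimit.
Context {R : realType} (F : set_system nat) (UF : UltraFilter F)
  (Foo : F --> \oo).

Lemma ultra_itv_cvg (f : nat -> R) (b c : R) :
  (\forall t \near F, b <= f t <= c) -> cvg (f @ F).
Proof.
move=> fbc.
have [|l [_ fl]] := @segment_compact R b c (f @ F) _.
  by apply: filterS fbc => t; rewrite /= in_itv.
apply/cvg_ex; exists l => U Ul.
have [//|FU] := in_ultra_setVsetC (f @^-1` U) UF.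
have FV : (f @ F) (~` U) by [].
by have [x []] := fl _ _ FV Ul.
Qed.

Lemma cvg_le_near (f g : nat -> R) (b c : R) : f @ F --> b -> g @ F --> c ->
  (\forall t \near F, f t <= g t) -> b <= c.
Proof.
move=> fb gc fg; rewrite -(cvg_lim (@Rhausdorff R) fb) -(cvg_lim (@Rhausdorff R) gc).
by apply: ler_lim => //; [apply/cvg_ex; exists b|apply/cvg_ex; exists c].
Qed.

Lemma near_ge_ultra N0 : \forall N \near F, (N0 <= N)%N.
Proof. by apply: Foo; exact: nbhs_infty_ge. Qed.

Lemma near_inv_le_ultra (e : R) : 0 < e -> \forall N \near F, N%:R^-1 <= e.
Proof.
move=> e0; apply: filterS (near_ge_ultra (Num.trunc e^-1).+1) => N Ne.
have eN : e^-1 < N%:R.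
  by apply: lt_le_trans (proj2 (andP (truncn_itv _))) _; rewrite ?ler_nat// invr_ge0 ltW.
by rewrite invf_ple ?posrE ?ltW// (lt_trans _ eN)// invr_gt0.
Qed.

Context {n : nat} (alpha : nat -> 'I_n).

Definition scaled_visits (N : nat) (r : R) k : R :=
  (visits alpha (stage N r) k)%:R / N%:R.

(** Bounded sequences converge along an ultrafilter, so that the limit exists at
    all times [r] at once, with no extraction of subsequences. *)
Definition limit_visits (r : R) k : R := lim (scaled_visits N r k @[N --> F]).

(** Visits are counted in units of [N], and [expR r] is the limit of the number of
    stages in this unit: see [stage_cvg]. *)
Definition limit_freq (r : R) : 'rV[R]_n :=
  \row_k (expR (- r) * limit_visits r k).

Lemma stage_cvg (r : R) : (stage N r)%:R / N%:R @[N --> F] --> expR r.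
Proof.
apply/cvgrPdist_le => e e0.
near=> N.
have N0 : 0 < (N%:R : R) by rewrite ltr0n; near: N; exact: near_ge_ultra.
have eN : N%:R^-1 <= e by near: N; exact: near_inv_le_ultra.
have /andP[h1 h2] := stage_itv N r.
have -> : expR r = (N%:R * expR r) / N%:R by rewrite mulrC mulKf// gt_eqF.
rewrite -mulrBl normrM ger0_norm ?subr_ge0// ger0_norm ?invr_ge0 ?(ltW N0)//.
apply: le_trans eN; rewrite ler_piMl ?invr_ge0 ?(ltW N0)//.
by rewrite lerBlDl natr1 ltW.
Unshelve. all: by end_near. Qed.
Arguments stage_cvg : clear implicits.

Lemma limit_visits_cvg r k :
  scaled_visits N r k @[N --> F] --> limit_visits r k.
Proof.
apply: (@ultra_itv_cvg _ 0 (expR r)).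
apply: filterS (near_ge_ultra 1) => N N0.
have NR : 0 < (N%:R : R) by rewrite ltr0n.
rewrite divr_ge0//= ler_pdivrMr// mulrC.
by apply: le_trans (proj1 (andP (stage_itv N r))); rewrite ler_nat visits_le.
Qed.
Arguments limit_visits_cvg : clear implicits.

Lemma limit_visits_homo r r' k :
  r <= r' -> limit_visits r k <= limit_visits r' k.
Proof.
move=> rr'; apply: cvg_le_near (limit_visits_cvg r k) (limit_visits_cvg r' k) _.
by apply: nearW => N; rewrite ler_wpM2r// ler_nat visits_homo// stage_homo.
Qed.

Lemma limit_visits_gap r r' k : r <= r' ->
  limit_visits r' k - limit_visits r k <= expR r' - expR r.
Proof.
move=> rr'.
apply: cvg_le_near (cvgB (limit_visits_cvg r' k) (limit_visits_cvg r k))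
  (cvgB (stage_cvg r') (stage_cvg r)) _.
apply: nearW => N; rewrite /= /scaled_visits -!mulrBl ler_wpM2r// lerBlDl.
rewrite -[X in _ + X]/((stage N r')%:R - (stage N r)%:R).
by rewrite -natrB ?stage_homo// -natrD ler_nat visits_gap// stage_homo.
Qed.

Lemma limit_visits_constant r r' k :
  (\forall N \near F, visits alpha (stage N r') k = visits alpha (stage N r) k) ->
  limit_visits r' k = limit_visits r k.
Proof.
move=> E; apply/eqP; rewrite eq_le; apply/andP; split.
  apply: cvg_le_near (limit_visits_cvg r' k) (limit_visits_cvg r k) _.
  by apply: filterS E => N; rewrite /scaled_visits => ->.
apply: cvg_le_near (limit_visits_cvg r k) (limit_visits_cvg r' k) _.
by apply: filterS E => N; rewrite /scaled_visits => ->.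
Qed.

Lemma limit_visits_ge0 r k : 0 <= limit_visits r k.
Proof.
apply: cvg_le_near (cvg_cst 0) (limit_visits_cvg r k) _.
by apply: nearW => N; rewrite divr_ge0.
Qed.

Lemma sum_limit_visits r : \sum_k limit_visits r k = expR r.
Proof.
have h : \sum_k scaled_visits N r k @[N --> F] --> \sum_k limit_visits r k.
  by apply: cvg_fsum => k; exact: limit_visits_cvg.
have e : (fun N => \sum_k scaled_visits N r k) =
    (fun N => (stage N r)%:R / N%:R).
  by apply/funext => N; rewrite -mulr_suml -natr_sum sum_visits.
rewrite e in h.
by rewrite -(cvg_lim (@Rhausdorff R) h) (cvg_lim (@Rhausdorff R) (stage_cvg r)).
Qed.

Lemma limit_visits_le r k : limit_visits r k <= expR r.
Proof.
by rewrite -sum_limit_visits (bigD1 k)//= lerDl sumr_ge0// => *; exact: limit_visits_ge0.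
Qed.

Lemma limit_freq_simplex r : simplex (limit_freq r).
Proof.
split=> [k|]; first by rewrite mxE mulr_ge0 ?expR_ge0// limit_visits_ge0.
under eq_bigr do rewrite mxE.
by rewrite -mulr_sumr sum_limit_visits expRN mulVf// gt_eqF// expR_gt0.
Qed.

Lemma limit_freq_Lipschitz r r' : `|limit_freq r' - limit_freq r| <= `|r' - r|.
Proof.
wlog rr' : r r' / r <= r' => [wl|].
  have [|/ltW] := leP r r'; first exact: wl.
  by move=> /wl; rewrite (distrC (limit_freq r)) (distrC r).
rewrite [leRHS]ger0_norm ?subr_ge0//; apply: row_norm_le => [|k].
  by rewrite subr_ge0.
rewrite !mxE.
have : limit_visits r' k - limit_visits r k <= expR r' - expR r by exact: limit_visits_gap.
have := limit_visits_homo k rr'.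
have := limit_visits_le r k.
have := limit_visits_ge0 r k.
(* The coordinates to compare are [p * a] and [q * b]. *)
move: (limit_visits r k) (limit_visits r' k) => a b a0 ar ab ba.
pose q := expR (- r'); pose p := expR (- r).
have q0 : 0 < q by exact: expR_gt0.
have pq : q <= p by rewrite ler_expR lerN2.
have e1 : q * expR r' = 1 by rewrite /q expRN mulVf// gt_eqF// expR_gt0.
have e2 : p * expR r = 1 by rewrite /p expRN mulVf// gt_eqF// expR_gt0.
have e3 : q * expR r = expR (r - r') by rewrite -expRD addrC.
have := expR_ge1Dx (r - r'); rewrite -e3 -/p -/q => e4.
have h1 : q * b <= q * (a + expR r' - expR r) by rewrite ler_wpM2l ?(ltW q0)//; lra.
have h2 : q * a <= q * b by rewrite ler_wpM2l// ltW.
have h3 : q * a <= p * a by rewrite ler_wpM2r.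
have h4 : (p - q) * a <= (p - q) * expR r by rewrite ler_wpM2l// subr_ge0.
rewrite mulrBr mulrDr in h1; rewrite !mulrBl in h4.
by rewrite ler_norml; apply/andP; split; lra.
Qed.

Lemma freq_stage_cvg r : freq alpha (stage N r) @[N --> F] --> limit_freq r.
Proof.
apply: cvg_row => k; rewrite mxE mulrC expRN.
have h : scaled_visits N r k / ((stage N r)%:R / N%:R) @[N --> F] -->
    limit_visits r k / expR r.
  apply: cvgM; first exact: limit_visits_cvg.
  by apply: cvgV; [rewrite gt_eqF// expR_gt0|exact: stage_cvg].
apply: cvg_trans h; apply: near_eq_cvg.
apply: filterS (near_ge_ultra 1) => N N0.
have NR : N%:R != 0 :> R by rewrite pnatr_eq0 -lt0n.
by rewrite mxE /scaled_visits invfM invrK [_^-1 * N%:R]mulrC mulrA divfK.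
Qed.
Arguments freq_stage_cvg : clear implicits.

(** A common Lipschitz bound turns convergence at the points of a finite grid
    into uniform convergence on bounded intervals. *)
Lemma freq_stage_uniform (T e : R) : 0 < e ->
  \forall N \near F, forall r, 0 <= r <= T ->
    `|freq alpha (stage N r) - limit_freq r| <= e.
Proof.
move=> e0; pose d := e / 4; have d0 : 0 < d by rewrite divr_gt0.
pose K := (Num.trunc (T / d)).+1.
have grid : \forall N \near F, forall i : 'I_K,
    `|freq alpha (stage N (i%:R * d)) - limit_freq (i%:R * d)| <= d.
  apply: filter_forall => i.
  by have /cvgrPdist_le/(_ d d0) := freq_stage_cvg (i%:R * d);
     apply: filterS => N; rewrite distrC.
near=> N => r /andP[r0 rT].
have N0 : (0 < N)%N by near: N; exact: near_ge_ultra.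
have Nd : N%:R^-1 <= d by near: N; exact: near_inv_le_ultra.
have rd0 : 0 <= r / d by rewrite divr_ge0// ltW.
(* [p] is the grid point immediately below [r]. *)
pose i := Num.trunc (r / d); pose p : R := i%:R * d.
have iK : (i < K)%N by rewrite ltnS; apply: le_truncn; rewrite ler_pM2r ?invr_gt0.
have /andP[] := truncn_itv rd0; rewrite -/i ler_pdivlMr// ltr_pdivrMr// -/p => pr.
rewrite -natr1 mulrDl mul1r -/p => rp.
have p0 : 0 <= p by rewrite mulr_ge0// ltW.
have h1 : `|freq alpha (stage N r) - freq alpha (stage N p)| <= d + d.
  apply: le_trans (freq_gap _ _ (stage_homo N pr)) _.
    exact: leq_trans N0 (stage_ge N p0).
  apply: le_trans (stage_ratio N0 p0 pr _ _ _) _ => //; first exact: stage_homo.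
  by rewrite lerD// lerBlDl ltW// addrC.
have h2 : `|freq alpha (stage N p) - limit_freq p| <= d.
  have /(_ (Ordinal iK)) : forall i : 'I_K,
    `|freq alpha (stage N (i%:R * d)) - limit_freq (i%:R * d)| <= d.
    by near: N; exact: grid.
  exact.
have h3 : `|limit_freq p - limit_freq r| <= d.
  apply: le_trans (limit_freq_Lipschitz _ _) _.
  by rewrite distrC ger0_norm ?subr_ge0// lerBlDl ltW// addrC.
have -> : freq alpha (stage N r) - limit_freq r =
  (freq alpha (stage N r) - freq alpha (stage N p)) +
  (freq alpha (stage N p) - limit_freq p) + (limit_freq p - limit_freq r).
  by rewrite !addrA !subrK.
have -> : e = d + d + d + d by rewrite /d; field.
exact: le_trans (ler_normD _ _) (lerD (le_trans (ler_normD _ _) (lerD h1 h2)) h3).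
Unshelve. all: by end_near. Qed.

End UltraLimit.

(** * The limits solve the best-reply dynamics *)

Section RightDerivative.
Context {R : realType}.

Lemma right_quotient_cvg (f : R -> R) x : derivable f x 1 ->
  h^-1 * (f (x + h) - f x) @[h --> 0^'+] --> 'D_1 f x.
Proof.
move=> df; apply: cvg_dnbhs_at_right.
have q : h^-1 *: ((f \o shift x) (h *: 1) - f x) @[h --> 0^'] --> 'D_1 f x.
  exact: df.
apply: cvg_trans q; apply: near_eq_cvg; near=> h.
by rewrite /= [h *: 1]mulr1 [x + h]addrC.
Unshelve. all: by end_near. Qed.

Lemma right_derivative_ge0 (f : R -> R) x : derivable f x 1 ->
  {homo f : y z / y <= z} -> 0 <= 'D_1 f x.
Proof.
move=> df fh.
rewrite -(cvg_lim (@Rhausdorff R) (right_quotient_cvg df)).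
apply: limr_ge; first by apply/cvg_ex; exists ('D_1 f x); exact: right_quotient_cvg.
near=> h.
have h0 : 0 < h by near: h; exact: nbhs_right_gt.
by rewrite mulr_ge0 ?invr_ge0 ?(ltW h0)// subr_ge0 fh// lerDl ltW.
Unshelve. all: by end_near. Qed.

Lemma right_derivative_flat (f : R -> R) x (d : R) : derivable f x 1 -> 0 < d ->
  (forall y, x <= y <= x + d -> f y = f x) -> 'D_1 f x = 0.
Proof.
move=> df d0 ff; rewrite -(cvg_lim (@Rhausdorff R) (right_quotient_cvg df)).
apply: cvg_lim; first exact: Rhausdorff.
have c0 : (0 : R) @[_ --> (0 : R)^'+] --> (0 : R) by exact: cvg_cst.
apply: cvg_trans c0; apply: near_eq_cvg; near=> h.
have h0 : 0 < h by near: h; exact: nbhs_right_gt.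
have hd : h <= d by near: h; exact: nbhs_right_le.
by rewrite ff ?subrr ?mulr0// lerDl lerD2l (ltW h0).
Unshelve. all: by end_near. Qed.

Lemma is_derive_pair (V W : normedModType R) (f : R -> V) (g : R -> W)
    (x : R) a b :
  is_derive x 1 f a -> is_derive x 1 g b ->
  is_derive x 1 (fun t => (f t, g t)) (a, b).
Proof.
move=> [df fa] [dg gb].
have c : h^-1 *: (((fun t => (f t, g t)) \o shift x) (h *: 1) - (f x, g x))
    @[h --> 0^'] --> (a, b).
  by rewrite -fa -gb; exact: (cvg_pair df dg).
split; first by apply/cvg_ex; exists (a, b).
by apply: cvg_lim => //; exact: norm_hausdorff.
Qed.

Lemma is_derive_row n (f : R -> 'rV[R]_n) (x : R) :
  (forall k, derivable (fun t => f t 0 k) x 1) ->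
  is_derive x 1 f (\row_k 'D_1 (fun t => f t 0 k) x).
Proof.
move=> df.
have d : derivable f x 1 by apply/derivable_mxP => i k; rewrite ord1.
split => //; rewrite derive_mx//.
by apply/rowP => k; rewrite !mxE.
Qed.

End RightDerivative.

Section LimitSolution.
Context {R : realType}.

Definition asymptotic_best_reply m n (u : 'M[R]_(m, n)) (alpha : nat -> 'I_m)
    (beta : nat -> 'I_n) : Prop :=
  forall e : R, 0 < e -> \forall t \near \oo, forall k,
    payoff u (vertex k) (freq beta t) - e <=
    payoff u (vertex (alpha t.+1)) (freq beta t).

Context (F : set_system nat) (UF : UltraFilter F) (Foo : F --> \oo).

Section OnePlayer.
Context {m n : nat} (u : 'M[R]_(m.+1, n)).
Context (alpha : nat -> 'I_m.+1) (beta : nat -> 'I_n).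
Hypothesis alphaBR : asymptotic_best_reply u alpha beta.

Notation v := (limit_freq (R := R) F alpha).
Notation w := (limit_freq (R := R) F beta).
Notation G := (limit_visits (R := R) F alpha).

(** By continuity and bounded speed, for a short time after [r] the frequencies of
    the opponent keep [k] worse than [k'] by a fixed amount, more than the error
    allowed in late stages; so [k] is not played at all. *)
Lemma limit_visits_flat r k k' : 0 <= r ->
  payoff u (vertex k) (w r) < payoff u (vertex k') (w r) ->
  exists2 d : R, 0 < d & forall s, r <= s <= r + d -> G s k = G r k.
Proof.
move=> r0 kk'.
pose gap y := payoff u (vertex k') y - payoff u (vertex k) y.
pose e := gap (w r) / 2.
have e0 : 0 < e by rewrite divr_gt0// subr_gt0.
have gap_cont : {for w r, continuous gap}.
  have pc j : {for w r, continuous (fun y => payoff u (vertex j) y)}.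
    exact: payoff_continuous.
  exact: cvgB (pc k') (pc k).
have /nbhs_ballP [rho /= rho0 near_gap] : \forall y \near w r, e < gap y.
  apply: (gap_cont [set z | e < z]); apply: lt_nbhsr.
  by rewrite /e; move: e0; rewrite /e; lra.
pose d := rho / 4; have d0 : 0 < d by rewrite divr_gt0.
exists d => // s /andP[rs sd].
have near_BR : \forall N \near F, forall t, (N <= t)%N -> forall k,
    payoff u (vertex k) (freq beta t) - e <=
    payoff u (vertex (alpha t.+1)) (freq beta t).
  have [T _ hT] := alphaBR e0; apply: filterS (near_ge_ultra Foo T) => N' TN' t' Nt'.
  by apply: hT; exact: leq_trans TN' Nt'.
apply: (limit_visits_constant UF Foo); near=> N.
have N0 : (0 < N)%N by near: N; exact: near_ge_ultra.
have Nd : N%:R^-1 <= d by near: N; exact: near_inv_le_ultra.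
have close : `|w r - freq beta (stage N r)| <= d.
  near: N; have /cvgrPdist_le := @freq_stage_cvg _ F UF Foo _ beta r; exact.
apply: visits_constant; first exact: stage_homo.
move=> t /andP[rt ts]; apply/negP => /eqP atk.
have t0 : (0 < t)%N by apply: leq_trans rt; apply: leq_trans N0 (stage_ge N r0).
have : e < gap (freq beta t).
  apply: near_gap; rewrite -ball_normE /ball_ /=.
  rewrite -(subrK (freq beta (stage N r)) (w r)) -addrA.
  apply: le_lt_trans (ler_normD _ _) _.
  have h : `|freq beta (stage N r) - freq beta t| <= d + d.
    rewrite distrC; apply: le_trans (freq_gap _ _ rt) _.
      exact: leq_trans N0 (stage_ge N r0).
    apply: le_trans (stage_ratio N0 r0 rs _ _ (ltnW ts)) _ => //.
    by rewrite lerD// lerBlDl.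
  have := lerD close h; move/le_lt_trans; apply.
  by rewrite /d; lra.
suff : gap (freq beta t) <= e by case: leP.
rewrite lerBlDl -lerBlDr -atk.
have tN : (N <= t)%N by apply: leq_trans rt; exact: stage_ge.
have BRN : forall t, (N <= t)%N -> forall k,
    payoff u (vertex k) (freq beta t) - e <=
    payoff u (vertex (alpha t.+1)) (freq beta t) by near: N.
exact: BRN.
Unshelve. all: by end_near. Qed.

(** Since [v] is [expR (- r) * G], the vector [v + v'] is [expR (- r) * G'].  It is
    nonnegative because [G] is nondecreasing, sums to 1 because [v] does at all
    times, and vanishes where [G] is flat, that is on the actions that are not
    best replies. *)
Lemma limit_freq_BR r : 0 <= r -> (forall k, derivable (fun s => v s 0 k) r 1) ->
  BRi u (w r) (v r + \row_k 'D_1 (fun s => v s 0 k) r).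
Proof.
move=> r0 dv.
have Gv k : G^~ k = expR * (fun s => v s 0 k).
  apply/funext => s.
  by rewrite /GRing.mul /= mxE mulrA expRN mulfV ?mul1r// gt_eqF// expR_gt0.
have dG k : is_derive r 1 (G^~ k)
    (expR r * (v r 0 k + 'D_1 (fun s => v s 0 k) r)).
  have dvk : is_derive r 1 (fun s => v s 0 k) ('D_1 (fun s => v s 0 k) r).
    exact: derivableP.
  rewrite Gv; apply: is_derive_eq (is_deriveM (is_derive_expR r) dvk) _.
  by rewrite addrC mulrDr /GRing.scale /= mulrC.
have bG k : v r 0 k + 'D_1 (fun s => v s 0 k) r = expR (- r) * 'D_1 (G^~ k) r.
  by rewrite (derive_val (is_derive := dG k)) expRN mulKf// gt_eqF// expR_gt0.
have dGk k : derivable (G^~ k) r 1 by case: (dG k).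
apply: BRi_support => [|k k' kk'].
  split=> [k|].
    rewrite mxE [X in _ + X]mxE bG mulr_ge0 ?expR_ge0//.
    apply: right_derivative_ge0 (dGk k) _ => x y.
    exact: (limit_visits_homo UF Foo).
  under eq_bigr do rewrite mxE [X in _ + X]mxE.
  rewrite big_split /= (proj2 (limit_freq_simplex UF Foo alpha r)).
  suff -> : \sum_k 'D_1 (fun s => v s 0 k) r = 0 by rewrite addr0.
  have F0 : Filter (0 : R)^'+ := at_right_proper_filter 0.
  have q := @cvg_fsum _ _ _ _ F0 _ _ (fun k => right_quotient_cvg (dv k)).
  rewrite -(cvg_lim (@Rhausdorff R) q).
  apply: cvg_lim; first exact: Rhausdorff.
  have c0 : (0 : R) @[_ --> (0 : R)^'+] --> (0 : R) by exact: cvg_cst.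
  apply: cvg_trans c0; apply: near_eq_cvg; apply: nearW => h.
  rewrite -mulr_sumr sumrB.
  by rewrite !(proj2 (limit_freq_simplex UF Foo alpha _)) subrr mulr0.
have [d d0 flat] := limit_visits_flat r0 kk'.
by rewrite mxE [X in _ + X]mxE bG (right_derivative_flat (dGk k) d0 flat) mulr0.
Qed.

Lemma limit_freq_derivable_ae :
  {ae lebesgue_measure, forall r : R, forall k, derivable (fun s => v s 0 k) r 1}.
Proof.
have ae_filter := ae_filter_ringOfSetsType (@lebesgue_measure R).
apply: (@filter_forall _ _ (fun k r => derivable (fun s => v s 0 k) r 1)) => k.
apply: (@Lipschitz_derivable_ae _ _ 1) => x y; rewrite mul1r.
have -> : v x 0 k - v y 0 k = (v x - v y) 0 k by rewrite !mxE.
apply: le_trans (coord_norm_le _ _) _; exact: (limit_freq_Lipschitz UF Foo).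
Qed.

End OnePlayer.

Lemma limit_best_reply_solution m n (u1 u2 : 'M[R]_(m.+1, n.+1)) alpha beta :
  asymptotic_best_reply u1 alpha beta -> asymptotic_best_reply u2^T beta alpha ->
  best_reply_solution u1 u2
    (fun r => (limit_freq F alpha r, limit_freq F beta r)).
Proof.
move=> BRa BRb; split.
- by move=> r _; split; exact: (limit_freq_simplex UF Foo).
- move=> T e e0; exists e => // N s t st _; apply: le_lt_trans.
  apply: ler_sum => i _; have [_ sti _] := st i.
  rewrite -[leRHS]gtr0_norm ?subr_gt0//.
 rewrite (@pair_norm_le R) /=; apply/andP.
  by split; exact: (limit_freq_Lipschitz UF Foo).
- have ae_filter := ae_filter_ringOfSetsType (@lebesgue_measure R).
  apply: filterS2 (limit_freq_derivable_ae alpha) (limit_freq_derivable_ae beta).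
  move=> r da db r0.
  exists (limit_freq F alpha r + \row_k 'D_1 (fun s => limit_freq F alpha s 0 k) r,
          limit_freq F beta r + \row_k 'D_1 (fun s => limit_freq F beta s 0 k) r).
    by split; apply: limit_freq_BR; rewrite ?ltW.
  rewrite (_ : _ - _ = (\row_k 'D_1 (fun s => limit_freq F alpha s 0 k) r,
      \row_k 'D_1 (fun s => limit_freq F beta s 0 k) r)).
    exact: is_derive_pair (is_derive_row da) (is_derive_row db).
  by congr (_, _) => /=; rewrite addrC addKr.
Qed.

End LimitSolution.

(** * Limit sets of asymptotic best replies are internally chain transitive *)

Section ChainTransitivity.
Context {R : realType} {m n : nat} (u1 u2 : 'M[R]_(m.+1, n.+1)).
Context (alpha : nat -> 'I_m.+1) (beta : nat -> 'I_n.+1).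
Hypothesis alphaBR : asymptotic_best_reply u1 alpha beta.
Hypothesis betaBR : asymptotic_best_reply u2^T beta alpha.

Let x t : 'rV[R]_m.+1 * 'rV[R]_n.+1 := (freq alpha t, freq beta t).
Let L := cluster (x @ \oo).

(** Otherwise the stages [N] from which no solution shadows the frequencies are
    unboundedly many, and they belong to an ultrafilter that converges to
    infinity.  The limit along it is a solution in [L] that the frequencies follow
    uniformly from some of these very stages. *)
Lemma limit_set_shadowing (T e : R) : 0 < e ->
  exists N0, forall N, (N0 <= N)%N -> exists y : R -> 'rV[R]_m.+1 * 'rV[R]_n.+1,
    [/\ best_reply_solution u1 u2 y, forall s, 0 <= s -> L (y s) &
      forall s, 0 <= s <= T -> `|x (stage N s) - y s| <= e].
Proof.
move=> e0.
pose good N := exists y : R -> 'rV[R]_m.+1 * 'rV[R]_n.+1,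
    [/\ best_reply_solution u1 u2 y, forall s, 0 <= s -> L (y s) &
      forall s, 0 <= s <= T -> `|x (stage N s) - y s| <= e].
change (exists N0, forall N, (N0 <= N)%N -> good N).
apply: contrapT => /forallNP nogood.
have bad N0 : exists2 N, (N0 <= N)%N & ~ good N.
  by have /existsNP [N /not_implyP [? ?]] := nogood N0; exists N.
pose G : set_system nat :=
  [set A | exists N0, forall N, (N0 <= N)%N -> ~ good N -> A N].
have GF : ProperFilter G.
  apply: Build_ProperFilter_ex.
    by move=> A [N0 hA]; have [N NN0 gN] := bad N0; exists N; exact: hA.
  split.
  - by exists 0%N.
  - move=> A B [NA hA] [NB hB]; exists (maxn NA NB) => N.
    by rewrite geq_max => /andP[? ?] ?; split; [exact: hA|exact: hB].
  - by move=> A B AB [N0 hA]; exists N0 => N N0N gN; exact/AB/hA.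
have [F [UF GsubF]] := ultraFilterLemma GF.
have Foo : F --> \oo.
  by move=> A [N0 _ hA]; apply: GsubF; exists N0 => N N0N _; exact: hA.
have Fbad : \forall N \near F, ~ good N by apply: GsubF; exists 0%N.
suff : exists N, ~ good N /\ good N by move=> [N []].
pose y r : 'rV[R]_m.+1 * 'rV[R]_n.+1 := (limit_freq F alpha r, limit_freq F beta r).
have y_sol : best_reply_solution u1 u2 y by exact: limit_best_reply_solution.
have yL s : 0 <= s -> L (y s).
  move=> s0 A B [N1 _ hA] yB.
  have xy : x (stage N s) @[N --> F] --> y s.
    exact: (cvg_pair (@freq_stage_cvg _ F UF Foo _ alpha s)
      (@freq_stage_cvg _ F UF Foo _ beta s)).
  have /filter_ex [N [N1N BN]] : \forall N \near F, (N1 <= N)%N /\ B (x (stage N s)).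
    by apply: filterI; [exact: (near_ge_ultra Foo)|exact: xy].
  exists (x (stage N s)); split => //; apply: hA.
  by rewrite /= (leq_trans N1N)// stage_ge.
have ua := freq_stage_uniform UF Foo alpha T e0.
have ub := freq_stage_uniform UF Foo beta T e0.
near F => N; exists N; split; first by near: N.
exists y; split => // s sT; rewrite pair_norm_le /=; apply/andP.
by split; move: s sT; near: N.
Unshelve. all: by end_near. Qed.

(** A chain with tolerance [e / 2] at both ends: the other halves pay for the
    distance from the frequencies to the points of [L] that they approach. *)
Definition linked_by_solutions (e T : R) (p q : 'rV[R]_m.+1 * 'rV[R]_n.+1) :=
  exists (K : nat) (Y : nat -> R -> 'rV[R]_m.+1 * 'rV[R]_n.+1) (t : nat -> R),
    [/\ (0 < K)%N,
        forall j, (1 <= j <= K)%N ->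
          [/\ best_reply_solution u1 u2 (Y j), T < t j &
              forall s, 0 <= s <= t j -> L (Y j s)],
        forall j, (1 <= j < K)%N -> `|Y j (t j) - Y j.+1 0| <= e,
        `|Y 1%N 0 - p| <= e / 2 &
        `|Y K (t K) - q| <= e / 2].

Lemma stage0 N : stage N (0 : R) = N.
Proof. by rewrite /stage expR0 mulr1 natrK. Qed.

(** Induction on the number of remaining stages: pieces of duration [T + 1] are cut
    off as long as another duration [T + 1] remains after them, so that the last
    piece is long enough too. *)
Lemma frequencies_linked (e T : R) : 0 < e -> 0 < T ->
  exists N0, forall N M, (N0 <= N)%N -> N%:R * expR (T + 1) <= M%:R ->
    linked_by_solutions e T (x N) (x M).
Proof.
move=> e0 T0; pose S := T + 1.
have e20 : 0 < e / 2 by rewrite divr_gt0.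
have S0 : 0 < S by rewrite addr_gt0.
have [N0 shadow] := limit_set_shadowing (S + S) e20.
exists N0.+1 => N M; have [d] := ubnP (M - N)%N.
elim: d N => // d IH N Nd N0N NM.
have N_gt0 : 0 < (N%:R : R) by rewrite ltr0n (leq_trans _ N0N).
have [y [ysol yL ysh]] := shadow _ (ltnW N0N).
have ySh0 : `|y 0 - x N| <= e / 2.
  by rewrite distrC -[X in x X]stage0 ysh// lexx addr_ge0// ltW.
have [big|small] := leP (N%:R * expR (S + S)) M%:R; last first.
  (* The remaining time is less than [2 * S]: a single piece reaches [M]. *)
  have M_gt0 : 0 < (M%:R : R) by apply: lt_le_trans NM; rewrite mulr_gt0// expR_gt0.
  have MN_gt0 : 0 < (M%:R : R) / N%:R by rewrite divr_gt0.
  pose t := ln ((M%:R : R) / N%:R).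
  have et : expR t = M%:R / N%:R by rewrite lnK// posrE.
  have tS : S <= t by rewrite -ler_expR et ler_pdivlMr// mulrC.
  have tSS : t <= S + S.
    by rewrite -ler_expR et ler_pdivrMr// mulrC ltW.
  have tM : stage N t = M by rewrite /stage et mulrC divfK ?natrK// gt_eqF.
  exists 1%N, (fun=> y), (fun=> t); split => //.
  - move=> j _; split => //; first by rewrite (lt_le_trans _ tS)// ltrDl.
    by move=> s /andP[s0 _]; exact: yL.
  - by case=> [|[]].
  - by rewrite distrC -[X in x X]tM ysh// tSS andbT (le_trans _ tS)// ltW.
pose N' := stage N S.
have NN' : (N < N')%N.
  rewrite /N' /stage truncn_ge_nat ?mulr_ge0 ?expR_ge0// -natr1.
  apply: (@le_trans _ _ (N%:R * (1 + S))).
    by rewrite mulrDr mulr1 lerD2l mulr_ege1 ?ler1n ?(leq_trans _ N0N)// lerDr ltW.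
  by rewrite ler_wpM2l// expR_ge1Dx.
have N'M : N'%:R * expR S <= M%:R.
  apply: le_trans big; rewrite expRD mulrA ler_wpM2r ?expR_ge0//.
  by case/andP: (stage_itv N S).
have [] := IH N' _ _ N'M; rewrite ?(leq_trans N0N (ltnW NN'))//.
  have : (N' <= M)%N.
    rewrite -(ler_nat R); apply: le_trans N'M.
    by rewrite ler_peMr// -expR0 ler_expR ltW.
  by move=> N'M'; rewrite (leq_trans _ (Nd : (M - N <= d)%N))// ltn_sub2l// (leq_trans NN').
move=> K [Y [t [K0 HY HJ H1 HK]]].
exists K.+1, (fun j => if (j <= 1)%N then y else Y j.-1),
  (fun j => if (j <= 1)%N then S else t j.-1); split => //.
- case=> [//|[_|j jK]] /=; last exact: HY.
  split => //; first by rewrite ltrDl.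
  by move=> s /andP[s0 _]; exact: yL.
- case=> [//|[_|j jK]] /=; last exact: HJ.
  rewrite -(subrK (x N') (y S)) -addrA (splitr e).
  apply: le_trans (ler_normD _ _) _; apply: lerD; last by rewrite distrC.
  by rewrite distrC ysh// (ltW S0) lerDl ltW.
- by case: K K0 HK {HY HJ}.
Qed.

(** Both points are approached at arbitrarily late stages, hence in the required
    order and as far apart as desired. *)
Lemma limit_set_internally_chain_transitive : internally_chain_transitive u1 u2 L.
Proof.
have mixed_compact : compact (@mixed_profiles R m n).
  by apply: compact_setX; exact: simplex_compact.
have x_mixed : \forall t \near \oo, @mixed_profiles R m n (x t).
  by exists 1%N => // t /= t0; split; exact: freq_simplex.
have L_mixed : L `<=` @mixed_profiles R m n.
  rewrite /L clusterE => p /(_ _ x_mixed).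
  have cl : closed (@mixed_profiles R m n).
    by apply: compact_closed => //; exact: norm_hausdorff.
  apply: subset_trans _ cl _; first exact: closureS.
have L_closed : closed L.
  by rewrite /L clusterE; apply: closed_bigI => A _; exact: closed_closure.
split => //.
- by have [p [_ Lp]] := mixed_compact (x @ \oo) _ x_mixed; exists p.
- exact: subclosed_compact L_closed mixed_compact L_mixed.
move=> p q Lp Lq e T e0 T0.
have visit r N0 : L r -> exists2 N, (N0 <= N)%N & `|x N - r| <= e / 2.
  move=> Lr; have [||_ [[N N0N <-] h]] := Lr (x @` [set N | (N0 <= N)%N])
      (ball r (e / 2)).
  - by exists N0 => // N /= N0N; exists N.
  - by apply: nbhsx_ballx; rewrite divr_gt0.
  exists N => //; move: h; rewrite -ball_normE /ball_ /= distrC; exact: ltW.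
have [N0 linked] := frequencies_linked e0 T0.
have [N N0N xNp] := visit p N0 Lp.
have [M NM xMq] := visit q (Num.trunc (N%:R * expR (T + 1))).+1 Lq.
have [|K [Y [t [K0 HY HJ H1 HK]]]] := linked N M N0N.
  by apply: ltW; apply: lt_le_trans (truncnS_gt _) _; rewrite ler_nat.
exists K, Y, t; split => //.
- rewrite -(subrK (x N) (Y 1%N 0)) -addrA (splitr e).
  by apply: le_trans (ler_normD _ _) _; apply: lerD.
- rewrite -(subrK (x M) (Y K (t K))) -addrA (splitr e).
  by apply: le_trans (ler_normD _ _) _; apply: lerD.
Qed.

End ChainTransitivity.

(** * A strong law for martingales on histories *)

Section Histories.
Context {m p : nat} {Omega : Type} (a : nat -> Omega -> 'I_m.+1 * 'I_p.+1).

Lemma historyS t w : history a t.+1 w = rcons (history a t w) (a t.+1 w).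
Proof.
by rewrite /history (_ : iota 1 t.+1 = rcons (iota 1 t) t.+1) ?map_rcons//
  -cats1 -[in LHS](addn1 t) iotaD add1n.
Qed.

Lemma size_history t w : size (history a t w) = t.
Proof. by rewrite size_map size_iota. Qed.

End Histories.

Section HistoryLaw.
Context {R : realType} {m p : nat} {d : measure_display}
  {Omega : measurableType d} (Pr : probability Omega R).
Notation action := ('I_m.+1 * 'I_p.+1)%type.
Context (q1 : seq action -> 'rV[R]_m.+1) (q2 : seq action -> 'rV[R]_p.+1)
  (a : nat -> Omega -> action).
Hypothesis q_simplex : forall h, simplex (q1 h) /\ simplex (q2 h).
Hypothesis a_gen : generated_by Pr q1 q2 a.

Implicit Types (h : seq action) (s : action).

Let q h s := q1 h 0 s.1 * q2 h 0 s.2.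

Lemma q_ge0 h s : 0 <= q h s.
Proof.
by have [[x _] [y _]] := q_simplex h; rewrite mulr_ge0.
Qed.

Lemma sum_q h : \sum_s q h s = 1.
Proof.
rewrite -(pair_bigA _ (fun k l => q1 h 0 k * q2 h 0 l)) /=.
have [[_ s1] [_ s2]] := q_simplex h.
by under eq_bigr do rewrite -mulr_sumr s2 mulr1.
Qed.

Definition follows h : set Omega := [set w | history a (size h) w = h].

Lemma follows_rcons h s :
  follows (rcons h s) = [set w | history a (size h) w = h /\ a (size h).+1 w = s].
Proof.
apply/seteqP; split=> w; rewrite /follows /= size_rcons historyS.
  by move/eqP; rewrite eqseq_rcons => /andP[/eqP -> /eqP ->].
by move=> [-> ->].
Qed.

Lemma measurable_follows h : measurable (follows h).
Proof.
elim/last_ind: h => [|h s IH].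
  by rewrite (_ : follows _ = setT)//; apply/seteqP; split.
by rewrite follows_rcons; apply: measurableI => //; exact: (proj1 a_gen).
Qed.

Definition history_prob h : R := fine (Pr (follows h)).

Lemma history_probE h : Pr (follows h) = (history_prob h)%:E.
Proof. by rewrite fineK// fin_num_measure//; exact: measurable_follows. Qed.

Lemma history_prob_ge0 h : 0 <= history_prob h.
Proof. by rewrite fine_ge0. Qed.

Lemma history_prob_rcons h s :
  history_prob (rcons h s) = q h s * history_prob h.
Proof.
rewrite /history_prob follows_rcons; case: s => k l.
by rewrite (proj2 a_gen) // -/(follows h) history_probE.
Qed.

Fixpoint histories t : seq (seq action) :=
  if t is t'.+1 then [seq rcons h s | h <- histories t', s <- enum {: action}]
  else [:: [::]].

Lemma history_in t w : history a t w \in histories t.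
Proof.
elim: t => [|t IH]; first by rewrite mem_seq1.
rewrite historyS; apply/allpairsP; exists (history a t w, a t.+1 w).
by split=> //; rewrite mem_enum.
Qed.

Lemma size_histories t h : h \in histories t -> size h = t.
Proof.
elim: t h => [h|t IH h]; first by rewrite mem_seq1 => /eqP ->.
by move=> /allpairsP [[h' s] /= [h't _ ->]]; rewrite size_rcons IH.
Qed.

(** Expectation over the first [t] stages, as a finite sum over histories. *)
Definition history_mean t (f : seq action -> R) : R :=
  \sum_(h <- histories t) f h * history_prob h.

Lemma history_meanS t f : history_mean t.+1 f =
  history_mean t (fun h => \sum_s q h s * f (rcons h s)).
Proof.
rewrite /history_mean big_allpairs_dep; apply: eq_bigr => h _.
rewrite mulr_suml big_enum /=; apply: eq_bigr => s _.
by rewrite history_prob_rcons mulrCA mulrA.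
Qed.

Lemma le_history_mean t f g : (forall h, f h <= g h) ->
  history_mean t f <= history_mean t g.
Proof.
by move=> fg; apply: ler_sum => h _; rewrite ler_wpM2r ?history_prob_ge0.
Qed.

Lemma history_mean1 t : history_mean t (fun=> 1) = 1.
Proof.
elim: t => [|t IH].
  rewrite /history_mean /= big_seq1 mul1r /history_prob.
  rewrite (_ : follows _ = setT) ?probability_setT//.
  by apply/seteqP; split.
rewrite history_meanS -[RHS]IH; apply: eq_bigr => h _; congr (_ * _).
by under eq_bigr do rewrite mulr1; exact: sum_q.
Qed.

(** Markov's inequality; the mean is a finite sum, so that only the union bound
    is involved. *)
Lemma history_markov t (f : seq action -> R) (c : R) : 0 < c ->
  (forall h, 0 <= f h) ->
  (Pr [set w | (c <= f (history a t w))%R] <= (history_mean t f / c)%:E)%E.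
Proof.
move=> c0 f0.
have cover : [set w | c <= f (history a t w)] =
    \big[setU/set0]_(h <- histories t | c <= f h) follows h.
  rewrite -bigcup_seq_cond; apply/seteqP; split=> w /=.
    move=> cf; exists (history a t w) => /=; first by rewrite history_in.
    by rewrite /follows /= size_history.
  move=> [h /andP[hin cf]]; rewrite /follows /= (size_histories hin).
  by move=> ->.
rewrite cover.
have -> : history_mean t f / c = \sum_(h <- histories t) f h / c * history_prob h.
  by rewrite /history_mean mulr_suml; apply: eq_bigr => h _; rewrite mulrAC.
elim: (histories t) => [|h hs IH]; first by rewrite !big_nil measure0.
rewrite !big_cons; case: ifPn => [cf|_]; last first.
  apply: le_trans IH _; rewrite lee_fin lerDr mulr_ge0 ?history_prob_ge0//.
  by rewrite divr_ge0// ltW.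
apply: le_trans (measureU2 _ _ _) _.
- exact: measurable_follows.
- by apply: bigsetU_measurable => *; exact: measurable_follows.
rewrite EFinD leeD//.
rewrite -[leLHS]/(Pr (follows h)) history_probE lee_fin ler_peMl ?history_prob_ge0//.
by rewrite ler_pdivlMr// mul1r.
Qed.

Lemma measurable_history_event t (P : seq action -> bool) :
  measurable [set w | P (history a t w)].
Proof.
have -> : [set w | P (history a t w)] =
    \big[setU/set0]_(h <- histories t | P h) follows h.
  rewrite -bigcup_seq_cond; apply/seteqP; split=> w /=.
    move=> cf; exists (history a t w) => /=; first by rewrite history_in.
    by rewrite /follows /= size_history.
  move=> [h /andP[hin cf]]; rewrite /follows /= (size_histories hin).
  by move=> ->.
by apply: bigsetU_measurable => *; exact: measurable_follows.
Qed.

(** At each stage, actions of conditional probability zero form a null event; this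
    transfers the support of the mixed actions to almost every path. *)
Lemma played_with_positive_probability :
  {ae Pr, forall w, forall t, q (history a t w) (a t.+1 w) != 0}.
Proof.
apply/ae_foralln => t.
pose null h' := q (take t h') (last (0, 0) h') == 0.
have nullE w : null (history a t.+1 w) = (q (history a t w) (a t.+1 w) == 0).
  by rewrite /null historyS -cats1 -[t in take t](size_history a t w) take_size_cat// last_cat.
exists [set w | null (history a t.+1 w)]; split.
- exact: measurable_history_event.
- apply/eqP; rewrite eq_le measure_ge0 andbT.
  have -> : [set w | null (history a t.+1 w)] =
      [set w | 1 <= (null (history a t.+1 w))%:R :> R].
    by apply/seteqP; split=> w /=; case: (null _); rewrite ?lexx// ler10.
  apply: le_trans (@history_markov t.+1 (fun h => (null h)%:R) 1 _ _) _ => //.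
  rewrite divr1 lee_fin history_meanS.
  rewrite /history_mean big_seq big1// => h /size_histories ht.
  rewrite big1 ?mul0r// => s _.
  rewrite /null -cats1 -[t in take t]ht take_size_cat// last_cat /=.
  by case: eqP => [->|_]; rewrite ?mul0r ?mulr0.
- by move=> w /= /negP; rewrite negbK -nullE.
Qed.

Section MartingaleLaw.
Context (D : seq action -> action -> R) (B : R).
Hypothesis D_bound : forall h s, `|D h s| <= B.
Hypothesis D_centered : forall h, \sum_s q h s * D h s = 0.

Definition martingale h : R :=
  \sum_(0 <= i < size h) D (take i h) (nth (0, 0) h i).

Lemma martingale_rcons h s : martingale (rcons h s) = martingale h + D h s.
Proof.
rewrite /martingale size_rcons big_nat_recr//=; congr (_ + _).
  apply: eq_big_nat => i /andP[_ ih].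
  by rewrite nth_rcons ih -cats1 take_cat ih.
by rewrite nth_rcons ltnn eqxx -cats1 take_size_cat.
Qed.

(** Increments are orthogonal to the past, so that second moments add up. *)
Lemma martingale_second_moment t :
  history_mean t (fun h => martingale h ^+ 2) <= B ^+ 2 * t%:R.
Proof.
elim: t => [|t IH].
  by rewrite /history_mean /= big_seq1 /martingale big_nil expr0n mul0r mulr0.
rewrite history_meanS.
apply: (@le_trans _ _ (history_mean t (fun h => martingale h ^+ 2 + B ^+ 2 * 1))).
  apply: le_history_mean => h.
  under eq_bigr do rewrite martingale_rcons sqrrD.
  have -> : \sum_s q h s * (martingale h ^+ 2 + martingale h * D h s *+ 2 + D h s ^+ 2)
     = martingale h ^+ 2 * \sum_s q h s + (martingale h * \sum_s q h s * D h s) *+ 2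
       + \sum_s q h s * D h s ^+ 2.
    rewrite !mulr_sumr -sumrMnl -!big_split /=; apply: eq_bigr => s _; ring.
  rewrite sum_q D_centered mulr1 mulr0 mul0rn addr0 lerD2l mulr1.
  rewrite -[leRHS]mul1r -(sum_q h) mulr_suml; apply: ler_sum => s _.
  rewrite ler_wpM2l ?q_ge0// -[leLHS]ger0_norm ?sqr_ge0// normrX.
  by rewrite lerXn2r ?nnegrE// (le_trans _ (D_bound h s)).
have -> : history_mean t (fun h => martingale h ^+ 2 + B ^+ 2 * 1) =
    history_mean t (fun h => martingale h ^+ 2) + B ^+ 2 * history_mean t (fun=> 1).
  rewrite /history_mean mulr_sumr -big_split /=; apply: eq_bigr => h _; ring.
by rewrite history_mean1 mulr1 -natr1 mulrDr mulr1 lerD2r.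
Qed.

Lemma sum_inverse_squares (N : nat) :
  \sum_(0 <= i < N) (i.+1%:R ^+ 2)^-1 <= 2 - N%:R^-1 :> R.
Proof.
elim: N => [|N IH]; first by rewrite big_nil invr0 subr0.
rewrite big_nat_recr//=.
have [->|N0] := posnP N.
  by rewrite big_nil add0r expr1n !invr1; lra.
have nR : 0 < (N%:R : R) by rewrite ltr0n.
apply: le_trans (lerD IH (lexx _)) _.
(* A telescoping bound. *)
suff : (N.+1%:R ^+ 2)^-1 <= N%:R^-1 - N.+1%:R^-1 :> R.
  by move=> h; rewrite -addrA lerD2l -lerBrDl opprK addrC.
have -> : N%:R^-1 - N.+1%:R^-1 = (N%:R * N.+1%:R)^-1 :> R.
  by rewrite -natr1; field; rewrite !gt_eqF// ltr_wpDl// ltW.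
by rewrite lef_pV2 ?posrE ?exprn_gt0 ?mulr_gt0// expr2 ler_wpM2r// ler_nat.
Qed.

Lemma martingale_gap w t k :
  `|martingale (history a (t + k) w) - martingale (history a t w)| <= B * k%:R.
Proof.
elim: k => [|k IH]; first by rewrite addn0 subrr normr0 mulr0.
rewrite addnS historyS martingale_rcons addrAC -natr1 mulrDr mulr1.
exact: le_trans (ler_normD _ _) (lerD IH (D_bound _ _)).
Qed.

(** Chebyshev's inequality at the stage [n ^ 2] bounds a probability by a multiple of
    [n ^- 2], which is summable: the Borel-Cantelli lemma applies. *)
Lemma martingale_at_squares (e : R) : 0 < e ->
  {ae Pr, forall w, exists N0, forall n, (N0 <= n)%N ->
    `|martingale (history a (n.+1 ^ 2) w)| <= e * n.+1%:R ^+ 2}.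
Proof.
move=> e0.
pose large n h := (e * n.+1%:R ^+ 2) ^+ 2 <= martingale h ^+ 2.
pose E n := [set w | large n (history a (n.+1 ^ 2) w)].
have mE n : measurable (E n) by exact: measurable_history_event.
have sq0 n : 0 < (n.+1%:R ^+ 2 : R) by rewrite exprn_gt0.
have PE n : (Pr (E n) <= ((B / e) ^+ 2 * (n.+1%:R ^+ 2)^-1)%:E)%E.
  apply: le_trans (@history_markov _ (fun h => martingale h ^+ 2) _ _ _) _ => //.
  - by rewrite exprn_gt0// mulr_gt0.
  - by move=> h; rewrite sqr_ge0.
  rewrite lee_fin ler_pdivrMr ?exprn_gt0 ?mulr_gt0//.
  apply: le_trans (martingale_second_moment _) _.
  rewrite le_eqVlt; apply/orP; left; apply/eqP; rewrite natrX.
  have : n.+1%:R != 0 :> R by rewrite pnatr_eq0.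
  have := lt0r_neq0 e0.
  by move: (n.+1%:R : R) => x en0 xn0; field; rewrite ?en0 ?xn0.
have sumE : (\sum_(0 <= n <oo) Pr (E n) < +oo)%E.
  apply: (@le_lt_trans _ _ ((B / e) ^+ 2 * 2)%:E); last by rewrite ltry.
  apply: lime_le; first by apply: is_cvg_nneseries => n _ _; exact: measure_ge0.
  apply: nearW => N.
  apply: (@le_trans _ _ (\sum_(0 <= n < N) ((B / e) ^+ 2 * (n.+1%:R ^+ 2)^-1)%:E)%E).
    by apply: lee_sum => n _; exact: PE.
  rewrite sumEFin lee_fin -mulr_sumr ler_wpM2l ?sqr_ge0//.
  by apply: le_trans (sum_inverse_squares N) _; rewrite gerBl invr_ge0.
exists (lim_sup_set E); split.
- by apply: bigcap_measurable => [|n _]; [exists 0%N|apply: bigcup_measurable].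
- exact: lim_sup_set_cvg0.
move=> w /= /forallNP often N0 _.
have /existsNP [n /not_implyP [N0n nE]] := often N0.
exists n => //=; rewrite /E /= /large.
move/negP : nE; rewrite -ltNge => /ltW lt.
rewrite -[leRHS]ger0_norm ?sqr_ge0// normrX lerXn2r ?nnegrE//.
by rewrite mulr_ge0 ?ltW.
Qed.

Lemma square_bracket t : (0 < t)%N -> exists n, (n.+1 ^ 2 <= t < n.+2 ^ 2)%N.
Proof.
elim: t => // -[|t] IH _; first by exists 0%N.
have [n /andP[nt tn]] := IH isT.
have [lt|ge] := ltnP t.+2 (n.+2 ^ 2); first by exists n; rewrite lt leqW.
exists n.+1; rewrite ge /=; apply: leq_ltn_trans tn _.
by rewrite ltn_exp2r.
Qed.

(** Between two consecutive squares, at distance of order the square root of [t],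
    bounded increments keep the martingale within [o(t)] of its values there. *)
Lemma martingale_strong_law :
  {ae Pr, forall w, forall e : R, 0 < e ->
    \forall t \near \oo, `|martingale (history a t w)| <= e * t%:R}.
Proof.
have /ae_foralln ae_sq : forall j : nat, {ae Pr, forall w, exists N0, forall n, (N0 <= n)%N ->
    `|martingale (history a (n.+1 ^ 2) w)| <= j.+1%:R^-1 * n.+1%:R ^+ 2}.
  by move=> j; apply: martingale_at_squares; rewrite invr_gt0.
apply: filterS ae_sq => w sq e e0.
have B0 : 0 <= B by apply: le_trans (D_bound [::] (0, 0)).
have e20 : 0 < e / 2 by rewrite divr_gt0.
have [N0 hN0] := sq (Num.trunc (e / 2)^-1).
have je : (Num.trunc (e / 2)^-1).+1%:R^-1 <= e / 2.
  by rewrite invf_ple ?posrE// ltW// truncnS_gt.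
pose N1 := maxn N0 (Num.trunc (3 * B / (e / 2))).+1.
exists (N1.+2 ^ 2)%N => // t /= N1t.
have t0 : (0 < t)%N by rewrite (leq_trans _ N1t)// expn_gt0.
have [n /andP[nt tn]] := square_bracket t0.
have N1n : (N1 <= n)%N.
  by have := leq_ltn_trans N1t tn; rewrite ltn_exp2r// !ltnS => /ltnW.
have N0n : (N0 <= n)%N by apply: leq_trans N1n; exact: leq_maxl.
have Bn : 3 * B <= e / 2 * n.+1%:R.
  rewrite [e / 2 * _]mulrC -ler_pdivrMr//; apply: ltW; apply: lt_le_trans (truncnS_gt _) _.
  by rewrite ler_nat leqW// (leq_trans _ N1n)// leq_maxr.
have gap : B * (t - n.+1 ^ 2)%:R <= e / 2 * n.+1%:R ^+ 2.
  apply: (@le_trans _ _ (B * (3 * n.+1%:R))).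
    rewrite ler_wpM2l// -natrM ler_nat leq_subLR -ltnS (leq_trans tn)//.
    by rewrite -!mulnn; lia.
  by rewrite mulrA [B * 3]mulrC expr2 mulrA ler_wpM2r.
have nt' : n.+1%:R ^+ 2 <= t%:R :> R by rewrite -natrX ler_nat.
apply: (@le_trans _ _ (e * n.+1%:R ^+ 2)); last by rewrite ler_wpM2l// ltW.
have -> : e * n.+1%:R ^+ 2 = e / 2 * n.+1%:R ^+ 2 + e / 2 * n.+1%:R ^+ 2 by field.
rewrite -(subnKC nt) -(subrK (martingale (history a (n.+1 ^ 2) w)) (martingale _)).
apply: le_trans (ler_normD _ _) _; apply: lerD.
  exact: le_trans (martingale_gap _ _ _) gap.
by apply: le_trans (hN0 n N0n) _; rewrite ler_wpM2r// exprn_ge0.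
Qed.

End MartingaleLaw.

End HistoryLaw.

(** * Convex potentials *)

Section Potential.
Context {R : realType} {n : nat} (P : 'rV[R]_n -> R).

Lemma directional_derivative x (v : 'rV[R]_n) : differentiable P x ->
  'D_v P x = \sum_k grad P x 0 k * v 0 k.
Proof.
move=> dP; rewrite deriveE// {1}(row_sum_delta v) linear_sum /=.
apply: eq_bigr => k _.
by rewrite linearZ /= mxE deriveE// mulrC.
Qed.

(** Convexity bounds the difference quotients at [x] in the direction [y - x], for
    steps in ]0, 1], by [P y - P x]; the directional derivative is their limit. *)
Lemma convex_gradient x y : differentiable P x -> convex_function setT P ->
  P x + \sum_k grad P x 0 k * (y - x) 0 k <= P y.
Proof.
move=> dP cP; rewrite -directional_derivative// -lerBrDl.
have q : h^-1 *: ((P \o shift x) (h *: (y - x)) - P x) @[h --> (0 : R)^'+] -->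
    'D_(y - x) P x.
  by apply: cvg_dnbhs_at_right; exact: diff_derivable.
rewrite -(cvg_lim (@Rhausdorff R) q).
apply: limr_le; first by apply/cvg_ex; exists ('D_(y - x) P x).
near=> h.
have h0 : 0 < h by near: h; exact: nbhs_right_gt.
have h1 : h <= 1 by near: h; exact: nbhs_right_le.
rewrite /= [_ *: _]mulrC ler_pdivrMr// lerBlDr.
have := cP (Itv01 (ltW h0) h1) y x (in_setT _) (in_setT _).
rewrite convRE.
rewrite [X in P X <= _](_ : _ = h *: (y - x) + x); last first.
  rewrite -[LHS]/(h *: y + (1 - h) *: x).
  by rewrite scalerBl scale1r scalerBr addrA addrAC.
move/le_trans; apply; rewrite -[leLHS]/(h * P y + (1 - h) * P x); lra.
Unshelve. all: by end_near. Qed.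

Hypothesis potP : potential P.

Lemma potential_differentiable x : differentiable P x.
Proof. by case: potP => -[dP _] *; exact: dP. Qed.

Lemma grad_continuous : continuous (grad P).
Proof. by case: potP => -[_ dP] *; move=> x; exact: differentiable_continuous. Qed.

Lemma potential_gradient x y :
  P x + \sum_k grad P x 0 k * (y - x) 0 k <= P y.
Proof.
by apply: convex_gradient; [exact: potential_differentiable|case: potP].
Qed.

(** A zero of the potential is a minimum, where the gradient has to vanish. *)
Lemma grad_at_zero x : P x = 0 -> grad P x = 0.
Proof.
move=> Px0; have [P0 _] : R1 P by case: potP.
have dir v : 0 <= 'D_v P x.
  have q : h^-1 *: ((P \o shift x) (h *: v) - P x) @[h --> (0 : R)^'+] -->
      'D_v P x.
    by apply: cvg_dnbhs_at_right; apply: diff_derivable; exact: potential_differentiable.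
  rewrite -(cvg_lim (@Rhausdorff R) q).
  apply: limr_ge; first by apply/cvg_ex; exists ('D_v P x).
  near=> h; rewrite Px0 subr0; apply: mulr_ge0; last exact: P0.
  by rewrite invr_ge0 ltW//; near: h; exact: nbhs_right_gt.
apply/rowP => k; rewrite !mxE; apply/eqP; rewrite eq_le dir andbT.
have := dir (- delta_mx 0 k).
suff -> : 'D_(- delta_mx 0 k) P x = - 'D_(delta_mx 0 k) P x by rewrite oppr_ge0.
have dP := potential_differentiable x.
rewrite !directional_derivative// -sumrN; apply: eq_bigr => j _.
by rewrite [X in _ * X]mxE mulrN.
Unshelve. all: by end_near. Qed.

Lemma grad_orthant x : orthant_neg x -> grad P x = 0.
Proof. by move=> xN; apply: grad_at_zero; case: potP => _ _ [_ ->]. Qed.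

Lemma potential_gt0 x : ~ orthant_neg x -> 0 < P x.
Proof.
move=> xN; case: potP => _ _ [P0 _] [_ R2P] _; rewrite lt_neqAle P0 andbT.
apply/negP => /eqP /esym /grad_at_zero g0; have := R2P x xN.
by under eq_bigr do rewrite g0 mxE mul0r; rewrite big1// ltxx.
Qed.

(** The tangent hyperplane at [x] lies below [P] at the origin, where [P] is 0. *)
Lemma potential_le_grad x : P x <= \sum_k grad P x 0 k * x 0 k.
Proof.
have := potential_gradient x 0.
have -> : P 0 = 0 by case: potP => _ _ [_ ->]// k; rewrite mxE.
under eq_bigr do rewrite sub0r [X in _ * X]mxE mulrN.
by rewrite sumrN subr_le0.
Qed.

End Potential.

Section Compactness.
Context {R : realType} {n : nat}.

Lemma closed_ball_compact (C : R) : compact [set x : 'rV[R]_n | `|x| <= C].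
Proof.
apply: bounded_closed_compact.
  by exists C; split; [exact: num_real|] => M CM x /= /le_trans; apply; exact: ltW.
have nc : continuous (fun x : 'rV[R]_n => `|x|) by exact: norm_continuous.
exact: ((continuous_closedP _).1 nc _ (@closed_le _ C)).
Qed.

Lemma compact_uniform_continuity (V : normedModType R) (f : 'rV[R]_n -> V)
    (C e : R) : continuous f -> 0 < e ->
  exists2 d : R, 0 < d & forall x y, `|x| <= C -> `|x - y| <= d -> `|f x - f y| <= e.
Proof.
move=> fc e0.
have /compact_near_coveringP cov := @closed_ball_compact C.
have : \forall d \near (0 : R)^'+, [set x : 'rV[R]_n | `|x| <= C] `<=`
    [set x | forall y, `|x - y| <= d -> `|f x - f y| <= e].
  apply: (cov R _ (fun d x => forall y, `|x - y| <= d -> `|f x - f y| <= e)) => x _.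
  have e20 : 0 < e / 2 by rewrite divr_gt0.
  have /nbhs_ballP [r /= r0 fr] : \forall y \near x, `|f x - f y| <= e / 2.
    by have /cvgrPdist_le := fc x; exact.
  have r20 : 0 < r / 2 by rewrite divr_gt0.
  exists (ball x (r / 2), [set d : R | d < r / 2]).
    by split; [exact: nbhsx_ballx|exact: nbhs_right_lt].
  move=> [z d] /= [xz dr] y zy.
  have h1 : `|f x - f z| <= e / 2.
    by apply: fr; apply: le_ball xz; lra.
  have h2 : `|f x - f y| <= e / 2.
    apply: fr; move: xz; rewrite -!ball_normE /ball_ /= => xz.
    rewrite -(subrK z x) -addrA (splitr r); apply: le_lt_trans (ler_normD _ _) _.
    by apply: ltrD => //; exact: le_lt_trans zy dr.
  rewrite -(subrK (f x) (f z)) -addrA (splitr e); apply: le_trans (ler_normD _ _) _.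
  by apply: lerD => //; rewrite distrC.
move=> h; near (0 : R)^'+ => d.
exists d; first by near: d; exact: nbhs_right_gt.
have H : [set x : 'rV[R]_n | `|x| <= C] `<=`
    [set x | forall y, `|x - y| <= d -> `|f x - f y| <= e] by near: d.
by move=> x y xC; exact: H.
Unshelve. all: by end_near. Qed.

Lemma compact_bounded (V : normedModType R) (f : 'rV[R]_n -> V) (C : R) :
  continuous f -> exists B, forall x, `|x| <= C -> `|f x| <= B.
Proof.
move=> fc.
have /compact_near_coveringP cov := @closed_ball_compact C.
have h : \forall B \near +oo, [set x : 'rV[R]_n | `|x| <= C] `<=`
    [set x | `|f x| <= B].
  apply: (cov R _ (fun B x => `|f x| <= B)) => x _.
  exists ([set y | `|f x - f y| <= 1], [set B : R | `|f x| + 1 <= B]).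
    split; last by apply: nbhs_pinfty_ge; rewrite num_real.
    by have /cvgrPdist_le := fc x; exact.
  move=> [z B] /= [h hB]; apply: le_trans hB.
  rewrite -{1}(subrK (f x) (f z)) addrC; apply: le_trans (ler_normD _ _) _.
  by rewrite lerD2l distrC.
near (pinfty_nbhs R) => B; exists B => x xC.
have H : [set x : 'rV[R]_n | `|x| <= C] `<=` [set x | `|f x| <= B] by near: B.
exact: H.
Unshelve. all: by end_near. Qed.

(** The potential is positive off the nonpositive orthant, hence bounded away from
    0 on the compact set of vectors with a coordinate that is at least [e]. *)
Lemma small_potential (P : 'rV[R]_n -> R) (C e : R) : potential P -> 0 < e ->
  exists2 d : R, 0 < d & forall x, `|x| <= C -> P x <= d -> forall k, x 0 k <= e.
Proof.
move=> potP e0.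
have Pc : continuous P.
  by move=> x; apply: differentiable_continuous; exact: potential_differentiable.
have /compact_near_coveringP cov := @closed_ball_compact C.
have h : \forall d \near (0 : R)^'+, [set x : 'rV[R]_n | `|x| <= C] `<=`
    [set x | P x <= d -> forall k, x 0 k <= e].
  apply: (cov R _ (fun d x => P x <= d -> forall k, x 0 k <= e)) => x _.
  have [xN|/(potential_gt0 potP) Px0] := pselect (orthant_neg x).
    exists (ball x e, [set: R]); first by split; [exact: nbhsx_ballx|exact: filterT].
    move=> [z d] /= [xz _] _ k; move: xz; rewrite -ball_normE /ball_ /= => xz.
    have := le_lt_trans (coord_norm_le (x - z) k) xz.
    rewrite !mxE distrC => /ltr_normlW; rewrite ltrBlDr => /ltW /le_trans; apply.
    by rewrite gerDl.
  have P20 : 0 < P x / 2 by rewrite divr_gt0.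
  exists ([set y | P x / 2 < P y], [set d : R | d < P x / 2]).
    split; last exact: nbhs_right_lt.
    apply: (Pc x [set z | P x / 2 < z]); apply: lt_nbhsr.
    by rewrite ltr_pdivrMr// ltr_pMr// ltr1n.
  by move=> [z d] /= [h1 h2] h3; have := lt_trans (lt_le_trans h1 h3) h2; rewrite ltxx.
near (0 : R)^'+ => d.
exists d; first by near: d; exact: nbhs_right_gt.
have H : [set x : 'rV[R]_n | `|x| <= C] `<=`
    [set x | P x <= d -> forall k, x 0 k <= e] by near: d.
by move=> x xC; exact: H.
Unshelve. all: by end_near. Qed.

End Compactness.

(** * No regret and asymptotic best replies *)

Section RegretAlgebra.
Context {R : realType} {m p : nat} (u : 'M[R]_(m.+1, p.+1)).
Notation action := ('I_m.+1 * 'I_p.+1)%type.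
Implicit Types (h : seq action) (s : action).

Lemma regretE (z : 'M[R]_(m.+1, p.+1)) k :
  regret u z 0 k = \sum_i \sum_l z i l * (u k l - u i l).
Proof.
rewrite mxE payoff_vertex /correlated_payoff.
have -> : \sum_l marginal z^T 0 l * u k l = \sum_i \sum_l z i l * u k l.
  rewrite exchange_big /=; apply: eq_bigr => l _.
  by rewrite mxE mulr_suml; apply: eq_bigr => i _; rewrite mxE.
rewrite -sumrB; apply: eq_bigr => i _; rewrite -sumrB; apply: eq_bigr => l _.
by rewrite mulrBr.
Qed.

Definition stage_regret s : 'rV[R]_m.+1 := \row_k (u k s.2 - u s.1 s.2).

Lemma scaled_average h k l :
  (size h)%:R * average_play (R := R) h k l =
  \sum_(s <- h) ((s.1 == k) && (s.2 == l))%:R.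
Proof.
rewrite mxE mulrA summxE.
have -> : \sum_(s <- h) (delta_mx s.1 s.2 : 'M[R]_(m.+1, p.+1)) k l =
    \sum_(s <- h) ((s.1 == k) && (s.2 == l))%:R.
  by apply: eq_bigr => s _; rewrite mxE [k == _]eq_sym [l == _]eq_sym.
case: h => [|s h]; first by rewrite !big_nil mulr0.
by rewrite mulfV ?mul1r// pnatr_eq0.
Qed.

Notation rho h := (regret u (average_play h)).

Lemma scaled_regret h : (size h)%:R *: rho h = \sum_(s <- h) stage_regret s.
Proof.
apply/rowP => k; rewrite mxE regretE summxE mulr_sumr.
under eq_bigr do rewrite mulr_sumr.
under eq_bigr do under eq_bigr do rewrite mulrA scaled_average mulr_suml.
under eq_bigr do rewrite exchange_big /=.
rewrite exchange_big /=; apply: eq_bigr => -[i l] _ /=.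
rewrite (bigD1 i)//= [X in _ + X]big1 ?addr0; last first.
  by move=> j /negbTE ji; apply: big1 => l' _; rewrite eq_sym ji mul0r.
rewrite (bigD1 l)//= [X in _ + X]big1 ?addr0; last first.
  by move=> l' /negbTE ll; rewrite [l == _]eq_sym ll andbF mul0r.
by rewrite !eqxx mul1r mxE.
Qed.

Lemma regret_rcons h s :
  (size h).+1%:R *: rho (rcons h s) = (size h)%:R *: rho h + stage_regret s.
Proof. by rewrite scaled_regret -(size_rcons h s) scaled_regret -cats1 big_cat big_seq1. Qed.

Definition regret_bound : R := \sum_s `|stage_regret s|.

Lemma regret_bound_ge0 : 0 <= regret_bound.
Proof. by apply: sumr_ge0. Qed.

Lemma stage_regret_le s : `|stage_regret s| <= regret_bound.
Proof. by rewrite /regret_bound (bigD1 s)//= lerDl sumr_ge0. Qed.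

Lemma regret_le h : `|rho h| <= regret_bound.
Proof.
have [h0|h0] := posnP (size h).
  have := scaled_regret h; rewrite (size0nil h0) /=.
  have -> : average_play [::] = 0 :> 'M[R]_(m.+1, p.+1).
    by rewrite /average_play big_nil scaler0.
  move=> _; apply: row_norm_le => [|k]; first exact: regret_bound_ge0.
  rewrite regretE big1 ?normr0 ?regret_bound_ge0// => i _.
  by rewrite big1// => l _; rewrite mxE mul0r.
have hR : 0 < ((size h)%:R : R) by rewrite ltr0n.
rewrite -(ler_pM2l hR) -{1}[(size h)%:R]ger0_norm ?(ltW hR)// -normrZ scaled_regret.
apply: le_trans (ler_norm_sum _ _ _) _.
elim: (h) => [|s h' IH]; first by rewrite big_nil mul0r.
by rewrite big_cons /= -natr1 mulrDl mul1r addrC lerD// stage_regret_le.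
Qed.

End RegretAlgebra.

Section NoRegret.
Context {R : realType} {m p : nat} (u : 'M[R]_(m.+1, p.+1)).
Notation action := ('I_m.+1 * 'I_p.+1)%type.
Implicit Types (h : seq action) (s : action).
Context (P : 'rV[R]_m.+1 -> R) (potP : potential P).

Notation rho h := (regret u (average_play h)).

Lemma not_orthant_vmax n (x : 'rV[R]_n.+1) : 0 < vmax x <-> ~ orthant_neg x.
Proof.
split=> [x0 xN|xN]; first by move: x0; rewrite ltNge vmax_le.
by rewrite ltNge; apply/negP => h; apply: xN => k; exact: le_trans (le_vmax x k) h.
Qed.

Lemma regret_nil : rho [::] = 0.
Proof.
apply/rowP => k; rewrite regretE mxE big1// => i _; apply: big1 => l _.
by rewrite /average_play big_nil scaler0 mxE mul0r.
Qed.

(** The first-order effect of the stage regret on [size h * P]. *)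
Definition noise h s : R := \sum_k grad P (rho h) 0 k * stage_regret u s 0 k.

Lemma noise_bounded : exists B, forall h s, `|noise h s| <= B.
Proof.
have [B hB] := compact_bounded (regret_bound u) (grad_continuous potP).
exists (\sum_(k < m.+1) B * regret_bound u) => h s.
apply: le_trans (ler_norm_sum _ _ _) _; apply: ler_sum => k _; rewrite normrM.
apply: ler_pM => //.
  exact: le_trans (coord_norm_le _ _) (hB _ (regret_le _ _)).
exact: le_trans (coord_norm_le _ _) (stage_regret_le _ _).
Qed.

(** Blackwell's condition: mixing proportionally to the gradient makes the
    expected stage regret orthogonal to the gradient, whatever the opponent
    plays. *)
Lemma noise_centered c (q1 : seq action -> 'rV[R]_m.+1)
    (q2 : seq action -> 'rV[R]_p.+1) h :
  simplex (q1 h) ->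
  ((0 < size h)%N -> no_regret_choice P c u (average_play h) (q1 h)) ->
  \sum_s q1 h 0 s.1 * q2 h 0 s.2 * noise h s = 0.
Proof.
move=> [_ q1_sum] choice.
have [xN|xP] := pselect (orthant_neg (rho h)).
  apply: big1 => s _; rewrite /noise big1 ?mulr0// => k _.
  by rewrite (grad_orthant potP xN) mxE mul0r.
have h0 : (0 < size h)%N.
  by case: h xP {choice q1_sum} => // -[] k; rewrite regret_nil mxE.
have qE := (choice h0).1 ((not_orthant_vmax _).2 xP).
set g := grad P (rho h) in qE *; pose G := \sum_k g 0 k.
have G0 : G != 0.
  apply/eqP => G0; have := q1_sum.
  under eq_bigr do rewrite qE -/G G0 invr0 mulr0.
  by rewrite big1// => /esym/eqP; rewrite oner_eq0.
have gE k : g 0 k = G * q1 h 0 k by rewrite qE mulrC divfK.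
rewrite -(pair_bigA _ (fun k l => q1 h 0 k * q2 h 0 l * noise h (k, l))) /=.
rewrite exchange_big /=; apply: big1 => l _.
pose U := \sum_k q1 h 0 k * u k l.
have noiseE i : noise h (i, l) = G * (U - u i l).
  have -> : U - u i l = \sum_k q1 h 0 k * (u k l - u i l).
    under eq_bigr do rewrite mulrBr.
    by rewrite sumrB -mulr_suml q1_sum mul1r.
  by rewrite mulr_sumr; apply: eq_bigr => k _; rewrite -/g gE mxE mulrA.
under eq_bigr do rewrite noiseE mulrAC mulrC.
rewrite -mulr_sumr.
have -> : \sum_i q1 h 0 i * (G * (U - u i l)) = 0; last by rewrite mulr0.
under eq_bigr do rewrite mulrCA mulrBr.
by rewrite -mulr_sumr sumrB -mulr_suml q1_sum mul1r subrr mulr0.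
Qed.

(** The tangent hyperplane at the new regret bounds its potential; uniform
    continuity on bounded sets replaces the new gradient by the old one at a cost
    that vanishes with the step, and [potential_le_grad] turns the drift towards
    0 into the change of weight from [size h] to [(size h).+1]. *)
Lemma lyapunov_step (e : R) : 0 < e -> exists T0, forall h s, (T0 <= size h)%N ->
  (size h).+1%:R * P (rho (rcons h s)) <=
  (size h)%:R * P (rho h) + noise h s + e.
Proof.
move=> e0; pose C := regret_bound u.
have C0 : 0 <= C by exact: regret_bound_ge0.
pose K := m.+1%:R * (C + C) + 1.
have K0 : 0 < K by rewrite /K ltr_wpDl// mulr_ge0// addr_ge0.
pose eta := e / K; have eta0 : 0 < eta by rewrite divr_gt0.
have [d d0 unif] := compact_uniform_continuity C (grad_continuous potP) eta0.
exists (Num.trunc ((C + C) / d)).+1 => h s Th.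
set t1 : R := (size h).+1%:R; set x := rho h; set y := rho (rcons h s).
set r := stage_regret u s.
have t10 : 0 < t1 by rewrite ltr0n.
have step : t1 *: (y - x) = r - x.
  rewrite scalerBr regret_rcons -/x -/r /t1 -natr1 scalerDl scale1r.
  by rewrite opprD addrACA subrr add0r.
have rx : `|r - x| <= C + C.
  by apply: le_trans (ler_normB _ _) _; apply: lerD; [exact: stage_regret_le|exact: regret_le].
have yx : `|x - y| <= d.
  rewrite distrC -(ler_pM2l t10) -{1}[t1]gtr0_norm// -normrZ step.
  apply: le_trans rx _; rewrite -ler_pdivrMr//; apply: ltW.
  by apply: lt_le_trans (truncnS_gt _) _; rewrite ler_nat leqW.
have gxy : `|grad P x - grad P y| <= eta by apply: unif => //; exact: regret_le.
have tangent : t1 * P y <= t1 * P x + \sum_k grad P y 0 k * (r - x) 0 k.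
  have -> : \sum_k grad P y 0 k * (r - x) 0 k =
      - (t1 * \sum_k grad P y 0 k * (x - y) 0 k).
    rewrite -step mulr_sumr -sumrN; apply: eq_bigr => k _.
    by rewrite [X in _ * X]mxE -[y - x]opprB [X in _ * (_ * X)]mxE; ring.
  by rewrite -mulrBr ler_pM2l// lerBrDr; exact: potential_gradient.
have split_sum : \sum_k grad P y 0 k * (r - x) 0 k = noise h s
    - \sum_k grad P x 0 k * x 0 k + \sum_k (grad P y - grad P x) 0 k * (r - x) 0 k.
  rewrite /noise -/x -/r -sumrB -big_split /=; apply: eq_bigr => k _.
  have -> : (r - x) 0 k = r 0 k - x 0 k by rewrite mxE [X in _ + X]mxE.
  have -> : (grad P y - grad P x) 0 k = grad P y 0 k - grad P x 0 k.
    by rewrite mxE [X in _ + X]mxE.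
  ring.
have err : \sum_k (grad P y - grad P x) 0 k * (r - x) 0 k <= e.
  apply: (@le_trans _ _ (\sum_(k < m.+1) eta * (C + C))).
    apply: ler_sum => k _; apply: le_trans (ler_norm _) _; rewrite normrM.
    apply: ler_pM => //.
      by apply: le_trans (coord_norm_le _ _) _; rewrite distrC.
    exact: le_trans (coord_norm_le _ _) rx.
  rewrite sumr_const card_ord -[leLHS]mulr_natl.
  have -> : m.+1%:R * (eta * (C + C)) = eta * (K - 1) by rewrite /K; ring.
  have -> : e = eta * K by rewrite /eta divfK// gt_eqF.
  by rewrite ler_pM2l// gerBl.
have := potential_le_grad potP x; rewrite /t1 -natr1 in tangent *; lra.
Qed.

Context (Omega : Type) (a : nat -> Omega -> action) (w : Omega).

Notation rho_ t := (rho (history a t w)).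

(** Summing [lyapunov_step] bounds [t * P] by a constant plus the martingale plus a
    small multiple of [t]. *)
Lemma potential_of_regret_vanishes :
  (forall e : R, 0 < e ->
    \forall t \near \oo, `|martingale noise (history a t w)| <= e * t%:R) ->
  forall e : R, 0 < e -> \forall t \near \oo, P (rho_ t) <= e.
Proof.
move=> small_noise e e0.
pose e3 := e / 3; have e30 : 0 < e3 by rewrite divr_gt0.
have [T0 step] := lyapunov_step e30.
pose M t := martingale noise (history a t w).
pose K := T0%:R * P (rho_ T0) - M T0.
have bound k : (T0 + k)%:R * P (rho_ (T0 + k)) <= K + M (T0 + k)%N + e3 * k%:R.
  elim: k => [|k IH]; first by rewrite addn0 mulr0 addr0 /K subrK.
  have := step (history a (T0 + k) w) (a (T0 + k).+1 w).
  rewrite size_history leq_addr -historyS addnS => /(_ isT).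
  have -> : M (T0 + k).+1 = M (T0 + k)%N + noise (history a (T0 + k) w) (a (T0 + k).+1 w).
    by rewrite /M historyS martingale_rcons.
  rewrite -[k.+1%:R]natr1 mulrDr mulr1; lra.
near=> t.
have T0t : (T0 <= t)%N by near: t; exact: nbhs_infty_ge.
have t0 : 0 < (t%:R : R) by rewrite ltr0n; near: t; exact: nbhs_infty_gt.
have Kt : K <= e3 * t%:R.
  rewrite mulrC -ler_pdivrMr//; near: t.
  exists (Num.trunc (K / e3)).+1 => // t /= Kt.
  by apply: ltW; apply: lt_le_trans (truncnS_gt _) _; rewrite ler_nat.
have Mt : M t <= e3 * t%:R.
  apply: le_trans (ler_norm _) _; near: t; exact: small_noise.
have := bound (t - T0)%N; rewrite subnKC// => bt.
rewrite -(ler_pM2l t0); apply: le_trans bt _.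
have : e3 * (t - T0)%:R <= e3 * t%:R by rewrite ler_pM2l// ler_nat leq_subr.
have -> : t%:R * e = e3 * t%:R + e3 * t%:R + e3 * t%:R by rewrite /e3; field.
lra.
Unshelve. all: by end_near. Qed.

Hypothesis noise_small : forall e : R, 0 < e ->
    \forall t \near \oo, `|martingale noise (history a t w)| <= e * t%:R.

Lemma no_regret (e : R) : 0 < e ->
  \forall t \near \oo, forall k, rho_ t 0 k <= e.
Proof.
move=> e0; have [d d0 small] := small_potential (regret_bound u) potP e0.
apply: filterS (potential_of_regret_vanishes noise_small d0) => t Pd.
by apply: small => //; exact: regret_le.
Qed.

Context (c : 'I_m.+1).
Hypothesis play : forall t, (0 < t)%N ->
  (0 < vmax (rho_ t) -> 0 < rho_ t 0 (a t.+1 w).1) /\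
  (vmax (rho_ t) <= 0 -> (a t.+1 w).1 = c).

Lemma regret_of_played t :
  t.+1%:R * rho_ t.+1 0 (a t.+1 w).1 = t%:R * rho_ t 0 (a t.+1 w).1.
Proof.
have := congr1 (fun x : 'rV_m.+1 => x 0 (a t.+1 w).1)
  (regret_rcons u (history a t w) (a t.+1 w)).
rewrite -historyS size_history mxE => ->.
by rewrite mxE [X in _ + X]mxE subrr addr0 mxE.
Qed.

(** An action with positive regret keeps it when it is played, since it does as
    well as itself at that stage. *)
Lemma positive_regret_persists t T : (0 < T)%N -> (T <= t)%N ->
  0 < vmax (rho_ T) -> 0 < vmax (rho_ t).
Proof.
move=> T0 /subnK <-; elim: (t - T)%N => // i IH vT.
have /(play (ltn_addl _ T0)).1 pos := IH vT.
rewrite addSn; apply: lt_le_trans (le_vmax _ (a (i + T).+1 w).1).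
rewrite -(@pmulr_rgt0 _ (i + T).+1%:R)// regret_of_played.
by rewrite mulr_gt0// ltr0n ltn_addl.
Qed.

Lemma eventually_positive_or_constant :
  (\forall t \near \oo, 0 < rho_ t 0 (a t.+1 w).1) \/
  (forall t, (0 < t)%N -> vmax (rho_ t) <= 0 /\ (a t.+1 w).1 = c).
Proof.
have [[T [T0 vT]]|none] := pselect (exists T, (0 < T)%N /\ 0 < vmax (rho_ T)).
  left; exists T => // t /= Tt.
  apply: (play (leq_trans T0 Tt)).1; exact: positive_regret_persists Tt vT.
right=> t t0; have vt : vmax (rho_ t) <= 0.
  by rewrite leNgt; apply/negP => vt; apply: none; exists t.
by split=> //; exact: (play t0).2.
Qed.

Lemma regret_of_constant : (forall t, (0 < t)%N -> (a t.+1 w).1 = c) ->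
  forall t, t.+1%:R * rho_ t.+1 0 c = rho_ 1%N 0 c.
Proof.
move=> ac; elim=> [|t IH]; first by rewrite mul1r.
by rewrite -IH -(ac t.+1 isT) regret_of_played.
Qed.

(** When regrets are eventually positive, that of the played action lies between 0
    and a maximum that tends to 0.  Otherwise all regrets are nonpositive, and that
    of [c] tends to 0 since its cumulative value is constant. *)
Lemma played_regret_asymptotically_maximal (e : R) : 0 < e ->
  \forall t \near \oo, forall k, rho_ t 0 k - e <= rho_ t 0 (a t.+1 w).1.
Proof.
move=> e0; have [pos|cst] := eventually_positive_or_constant.
  near=> t => k; apply: (@le_trans _ _ 0).
    by rewrite subr_le0; move: k; near: t; exact: no_regret.
  by apply: ltW; near: t.
near=> t => k.
have t0 : (0 < t)%N by near: t; exact: nbhs_infty_gt.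
have [vt ->] := cst t t0.
apply: (@le_trans _ _ (- e)); first by rewrite gerDr (le_trans (le_vmax _ k)).
have tR : 0 < (t%:R : R) by rewrite ltr0n.
have := regret_of_constant (fun t t0 => (cst t t0).2) t.-1; rewrite prednK// => tc.
rewrite -(ler_pM2l tR) tc mulrN lerNl -ler_pdivrMr//; near: t.
exists (Num.trunc (- rho_ 1%N 0 c / e)).+1 => // t /= ht.
by apply: ltW; apply: lt_le_trans (truncnS_gt _) _; rewrite ler_nat.
Unshelve. all: by end_near. Qed.

End NoRegret.

Section Beliefs.
Context {R : realType} {m p : nat} {Omega : Type}.
Context (a : nat -> Omega -> 'I_m.+1 * 'I_p.+1).

Lemma marginal_average t w :
  marginal (average_play (history a t w)) = freq (fun t => (a t w).1) t :> 'rV[R]_m.+1.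
Proof.
apply/rowP => k; rewrite !mxE.
under eq_bigr do rewrite mxE summxE.
rewrite -mulr_sumr exchange_big /= size_history mulrC; congr (_ / _).
rewrite big_map /visits natr_sum /index_iota subn1 /=; apply: eq_bigr => j _.
rewrite (bigD1 (a j w).2)//= big1 ?addr0 => [|l /negbTE lj].
  by rewrite mxE eqxx andbT eq_sym.
by rewrite mxE lj andbF.
Qed.

Lemma marginal_average_tr t w :
  marginal (average_play (history a t w))^T = freq (fun t => (a t w).2) t :> 'rV[R]_p.+1.
Proof.
apply/rowP => k; rewrite !mxE.
under eq_bigr do rewrite 2!mxE summxE.
rewrite -mulr_sumr exchange_big /= size_history mulrC; congr (_ / _).
rewrite big_map /visits natr_sum /index_iota subn1 /=; apply: eq_bigr => j _.
rewrite (bigD1 (a j w).1)//= big1 ?addr0 => [|l /negbTE lj].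
  by rewrite mxE eqxx eq_sym.
by rewrite mxE lj.
Qed.

(** At a given stage, regrets and payoffs of the pure actions differ by the same
    constant. *)
Lemma asymptotic_best_reply_regret (u : 'M[R]_(m.+1, p.+1)) w :
  (forall e : R, 0 < e -> \forall t \near \oo, forall k,
    regret u (average_play (history a t w)) 0 k - e <=
    regret u (average_play (history a t w)) 0 (a t.+1 w).1) ->
  asymptotic_best_reply u (fun t => (a t w).1) (fun t => (a t w).2).
Proof.
move=> h e e0; apply: filterS (h e e0) => t ht k; have := ht k.
by rewrite !mxE marginal_average_tr => ?; lra.
Qed.

End Beliefs.

(** * Almost sure internal chain transitivity *)

Section Assembly.
Context {R : realType} {d : measure_display} {Omega : measurableType d}
  (Pr : probability Omega R).

Lemma almost_sure_best_reply m p (u : 'M[R]_(m.+1, p.+1))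
    (q1 : seq ('I_m.+1 * 'I_p.+1) -> 'rV[R]_m.+1)
    (q2 : seq ('I_m.+1 * 'I_p.+1) -> 'rV[R]_p.+1)
    (a : nat -> Omega -> 'I_m.+1 * 'I_p.+1) P c :
  (forall h, simplex (q1 h) /\ simplex (q2 h)) ->
  generated_by Pr q1 q2 a -> potential P ->
  (forall h, (0 < size h)%N -> no_regret_choice P c u (average_play h) (q1 h)) ->
  {ae Pr, forall w,
    asymptotic_best_reply u (fun t => (a t w).1) (fun t => (a t w).2)}.
Proof.
move=> q_simplex a_gen potP choice.
have [B noiseB] := noise_bounded u potP.
have noise0 h := noise_centered potP q2 (q_simplex h).1 (choice h).
have positive := played_with_positive_probability a_gen.
have law := martingale_strong_law q_simplex a_gen noiseB noise0.
apply: filterS2 law positive => w small_noise pos.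
apply: asymptotic_best_reply_regret => e e0.
apply: (played_regret_asymptotically_maximal potP small_noise (c := c)) e0.
move=> t t0; have /(choice _) [qpos qneg] : (0 < size (history a t w))%N.
  by rewrite size_history.
have := pos t; rewrite mulf_eq0 negb_or => /andP[q1a _].
split=> [v0|v0]; last first.
  by apply/eqP; apply: contraNT q1a => ac; rewrite (qneg v0) mxE /= (negbTE ac).
rewrite ltNge; apply: contraNN q1a => neg; rewrite (qpos v0).
have [_ _ _ _ PR3] := potP.
by rewrite PR3 ?mul0r//; exact/not_orthant_vmax.
Qed.

(** Exchanging the players transposes the matrices, which carries what holds for
    player 1 over to player 2. *)
Definition swap (A B : Type) (s : A * B) : B * A := (s.2, s.1).

Lemma swapK (A B : Type) : cancel (@swap A B) (@swap B A).
Proof. by case. Qed.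

Context {m n : nat}.
Context (q1 : seq ('I_m.+1 * 'I_n.+1) -> 'rV[R]_m.+1)
  (q2 : seq ('I_m.+1 * 'I_n.+1) -> 'rV[R]_n.+1)
  (a : nat -> Omega -> 'I_m.+1 * 'I_n.+1).

Let a' t w := swap (a t w).
Let q1' (h : seq ('I_n.+1 * 'I_m.+1)) := q2 (map (@swap _ _) h).
Let q2' (h : seq ('I_n.+1 * 'I_m.+1)) := q1 (map (@swap _ _) h).

Lemma history_swap t w : history a' t w = map (@swap _ _) (history a t w).
Proof. by rewrite /history -map_comp. Qed.

Lemma history_swap_eq t w h :
  history a' t w = h <-> history a t w = map (@swap _ _) h.
Proof.
by rewrite history_swap; split=> [<-|->]; rewrite -map_comp map_id_in// => -[].
Qed.

Lemma average_play_swap (h : seq ('I_n.+1 * 'I_m.+1)) :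
  average_play (map (@swap _ _) h) = (average_play h)^T :> 'M[R]_(m.+1, n.+1).
Proof.
apply/matrixP => k l; rewrite !mxE !summxE size_map big_map; congr (_ * _).
by apply: eq_bigr => s _; rewrite !mxE andbC.
Qed.

Lemma generated_by_swap : generated_by Pr q1 q2 a -> generated_by Pr q1' q2' a'.
Proof.
move=> [ma Pa]; split=> [t s t0|t h l k ht].
  rewrite (_ : [set w | _] = [set w | a t w = swap s]); first exact: ma.
  by apply/seteqP; split=> w; rewrite /a' /=; [move=> <-|move=> ->]; rewrite swapK.
have -> : [set w | history a' t w = h] =
    [set w | history a t w = map (@swap _ _) h].
  by apply/seteqP; split=> w /=; rewrite history_swap_eq.
have -> : [set w | history a' t w = h /\ a' t.+1 w = (l, k)] =
    [set w | history a t w = map (@swap _ _) h /\ a t.+1 w = (k, l)].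
  apply/seteqP; split=> w /= []; rewrite history_swap_eq => -> E; split=> //.
    by move: E => /(congr1 (@swap _ _)); rewrite /a' swapK.
  by rewrite /a' E.
by rewrite Pa ?size_map// [(q1' _ _ _ * _)%R]mulrC.
Qed.

End Assembly.

Theorem theorem1 (R : realType) (m n : nat) (u1 u2 : 'M[R]_(m.+1, n.+1))
    (q1 : seq ('I_m.+1 * 'I_n.+1) -> 'rV[R]_m.+1)
    (q2 : seq ('I_m.+1 * 'I_n.+1) -> 'rV[R]_n.+1)
    (d : measure_display) (Omega : measurableType d)
    (Pr : probability Omega R) (a : nat -> Omega -> 'I_m.+1 * 'I_n.+1) :
  class_R u1 u2 q1 q2 ->
  generated_by Pr q1 q2 a ->
  {ae Pr, forall w,
    internally_chain_transitive u1 u2 (belief_limit_set a w)}.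
Proof.
move=> [q_simplex [P1 [c1 [potP1 choice1]]] [P2 [c2 [potP2 choice2]]]] a_gen.
have BR1 := almost_sure_best_reply q_simplex a_gen potP1 choice1.
have BR2 : {ae Pr, forall w,
    asymptotic_best_reply u2^T (fun t => (a t w).2) (fun t => (a t w).1)}.
  apply: (almost_sure_best_reply _ (generated_by_swap a_gen) potP2 (c := c2)).
    by move=> h; have [? ?] := q_simplex (map (@swap _ _) h).
  move=> h h0; rewrite -[average_play h]trmxK -average_play_swap.
  by apply: choice2; rewrite size_map.
apply: filterS2 BR1 BR2 => w BR1w BR2w.
rewrite /belief_limit_set.
have beliefsE t : beliefs (average_play (history a t w)) =
    (freq (fun t => (a t w).1) t, freq (fun t => (a t w).2) t) :> _ * 'rV[R]_n.+1.
  by rewrite /beliefs marginal_average marginal_average_tr.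
under eq_fun do rewrite beliefsE.
exact: limit_set_internally_chain_transitive.
Qed.
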